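(* Assume $-1\in\mathbb F^2$ and let $J=JCK(Z,\delta)$ and $K=Z\oplus Zx\subseteq J$. Then the Lie superalgebra $\mathrm{Der}(J)$ is isomorphic to $\mathcal T(K,\overline{\mathrm{Der}}(K))$, and the Lie superalgebra $\mathrm{Inder}(J)$ is isomorphic to $\mathcal T(K)=\mathcal T(K,\mathrm{Inder}(K))$.
   Context: Let $\mathbb F$ be a field of characteristic $\neq 2$ with $-1\in\mathbb F^2$, $Z$ a unital commutative associative $\mathbb F$-algebra, and $\delta$ a derivation of $Z$ such that $Z\delta(Z)=Z$ (the $\mathbb F$-span of all products $f\delta(g)$, $f,g\in Z$, is $Z$). The Cheng-Kac Jordan superalgebra $J=JCK(Z,\delta)=J_{\bar0}\oplus J_{\bar1}$ is defined as follows: $J_{\bar0}=Z1\oplus Zw_1\oplus Zw_2\oplus Zw_3$ and $J_{\bar1}=Zx\oplus Zx_1\oplus Zx_2\oplus Zx_3$ are free $Z$-modules of rank 4; $J_{\bar0}$ is the $Z$-algebra $(\mathbb F1\oplus\mathbb Fw_1\oplus\mathbb Fw_2\oplus\mathbb Fw_3)\otimes_{\mathbb F}Z$ with $1$ the identity, $w_1^2=w_2^2=1$, $w_3^2=-1$, $w_iw_j=0$ for $i\ne j$. For $f,g\in Z$ and $i,j\in\{1,2,3\}$ the remaining products are: $f(gx)=(fg)x$, $f(gx_j)=(fg)x_j$, $(fw_i)(gx)=(\delta(f)g)x_i$, $(fw_i)(gx_j)=-(fg)x_{i\times j}$, $(fx)(gx)=\delta(f)g-f\delta(g)$, $(fx)(gx_j)=-(fg)w_j$,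 $(fx_i)(gx)=(fg)w_i$, $(fx_i)(gx_j)=0$, extended by supercommutativity ($ab=(-1)^{|a||b|}ba$), where $x_{1\times2}=-x_{2\times1}=x_3$, $x_{1\times3}=-x_{3\times1}=x_2$, $x_{3\times2}=-x_{2\times3}=x_1$, $x_{i\times i}=0$. $K=Z\oplus Zx$ is a subalgebra of $J$. Derivations are super derivations; $D(a,b)$ is $c\mapsto a(bc)-(-1)^{|a||b|}b(ac)$ and $\mathrm{Inder}$ is their span. For $a\in Z$, $\eta_a$ is the odd derivation of $K$ with $\eta_a(Z)=0$, $\eta_a(x)=a$; $\overline{\mathrm{Der}}(K)=\mathrm{Der}(K)_{\bar0}\oplus\{\eta_a:a\in Z\}$, a subalgebra of $\mathrm{Der}(K)$ containing $\mathrm{Inder}(K)$. Tits construction: for a Jordan superalgebra $A$ and a subalgebra $\mathfrak d$ with $\mathrm{Inder}(A)\le\mathfrak d\le\mathrm{Der}(A)$, $\mathcal T(A,\mathfrak d)=(\mathfrak{so}_3\otimes A)\oplus\mathfrak d$, where $\mathfrak{so}_3$ is the Lie algebra of skew-symmetric $3\times3$ matrices over $\mathbb F$, with superanticommutative bracket: $\mathfrak d$ is a subalgebra, $[\partial,M\otimes a]=M\otimes\partial(a)$, and $[M\otimes a,N\otimes b]=[M,N]\otimes ab+\tfrac12\mathrm{trace}(MN)D(a,b)$ for $\partial\in\mathfrak d$, $M,N\in\mathfrak{so}_3$, $a,b\in A$; parity of $M\otimes a$ is that of $a$. $\mathcal T(A)$ denotes $\mathcal T(A,\mathrm{Inder}(A))$.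 *)

(* Defs.v *)
From HB Require Import structures.
From mathcomp Require Import all_boot all_order all_algebra.
Set Implicit Arguments. Unset Strict Implicit. Unset Printing Implicit Defensive.
Import GRing.Theory.
Local Open Scope ring_scope.

(* Generic notions for a superalgebra (V, mul) over F, where V is an         *)
(* F-vector space with Z/2-grading given by the projection p0 onto V_0       *)
(* (the projection onto V_1 is v - p0 v).                                    *)
(* Parities are booleans: false = even (0), true = odd (1).                  *)

Section Generic.
Variable F : fieldType.

Definition sgn (b : bool) : F := if b then -1 else 1.

Variable V : lmodType F.
Variable mul : V -> V -> V.
Variable p0 : V -> V.

Definition part (b : bool) (v : V) : V := if b then v - p0 v else p0 v.

Definition hom (b : bool) (v : V) : Prop := part b v = v.

Definition is_lin (f : V -> V) : Prop :=
  forall (k : F) (u v : V), f (k *: u + v) = k *: f u + f v.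

Definition is_sder (b : bool) (D : V -> V) : Prop :=
  is_lin D /\
  (forall (p : bool) (v : V), hom p v -> hom (addb p b) (D v)) /\
  (forall (p q : bool) (u v : V), hom p u -> hom q v ->
     D (mul u v) = mul (D u) v + sgn (b && p) *: mul u (D v)).

Definition is_Der (D : V -> V) : Prop :=
  exists D0 D1 : V -> V, is_sder false D0 /\ is_sder true D1 /\
    forall v, D v = D0 v + D1 v.

Definition mpart (b : bool) (D : V -> V) : V -> V :=
  fun v => \sum_(c <- [:: false; true]) part (addb c b) (D (part c v)).

Definition sbr (D E : V -> V) : V -> V :=
  fun v => \sum_(b <- [:: false; true]) \sum_(c <- [:: false; true])
     (mpart b D (mpart c E v) - sgn (b && c) *: mpart c E (mpart b D v)).

Definition Dop (a b : V) : V -> V :=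
  fun c => \sum_(p <- [:: false; true]) \sum_(q <- [:: false; true])
     (mul (part p a) (mul (part q b) c)
        - sgn (p && q) *: mul (part q b) (mul (part p a) c)).

Definition is_Inder (f : V -> V) : Prop :=
  exists s : seq (F * V * V),
    forall c, f c = \sum_(t <- s) t.1.1 *: Dop t.1.2 t.2 c.

End Generic.

(* Tits construction T(A, d) = (so_3 (x) A) (+) d.                           *)
(* so_3 (x) A is modelled canonically as the skew-symmetric 3x3 matrices     *)
(* with entries in A: M (x) a  <->  (M i j *: a)_{i,j}.  Under this          *)
(* identification  [M,N] (x) ab  has (i,j) entry                             *)
(*   sum_m (M_im a)(N_mj b) - (M_mj a)(N_im b)                               *)
(* and  trace(MN) D(a,b) = sum_{i,m} D(M_im a, N_mi b).                      *)

Section Tits.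
Variable F : fieldType.
Variable A : lmodType F.
Variable mul : A -> A -> A.
Variable p0 : A -> A.

Definition titsT : Type := ('I_3 -> 'I_3 -> A) * (A -> A).

Definition skew (X : 'I_3 -> 'I_3 -> A) : Prop := forall i j, X j i = - X i j.

Definition inT (d : (A -> A) -> Prop) (t : titsT) : Prop := skew t.1 /\ d t.2.

Definition teq (t t' : titsT) : Prop :=
  (forall i j, t.1 i j = t'.1 i j) /\ (forall a, t.2 a = t'.2 a).

Definition tlin (k : F) (t t' : titsT) : titsT :=
  (fun i j => k *: t.1 i j + t'.1 i j, fun a => k *: t.2 a + t'.2 a).

Definition tpart (b : bool) (t : titsT) : titsT :=
  (fun i j => part p0 b (t.1 i j), mpart p0 b t.2).

(* the super bracket of T(A,d):
   [d1, d2] super commutator, [d, M(x)a] = M(x)d(a),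
   [M(x)a, N(x)b] = [M,N](x)ab + 1/2 tr(MN) D(a,b), extended bilinearly *)
Definition tbr (t t' : titsT) : titsT :=
  (fun i j =>
     \sum_(m < 3) (mul (t.1 i m) (t'.1 m j) - mul (t.1 m j) (t'.1 i m))
     + t.2 (t'.1 i j)
     - \sum_(b <- [:: false; true]) \sum_(c <- [:: false; true])
          sgn F (b && c) *: mpart p0 c t'.2 (part p0 b (t.1 i j)),
   fun a =>
     sbr p0 t.2 t'.2 a
     + (2%:R : F)^-1 *: \sum_(i < 3) \sum_(m < 3) Dop mul p0 (t.1 i m) (t'.1 m i) a).

Definition tits_iso (V : lmodType F) (p0V : V -> V) (L : (V -> V) -> Prop)
    (d : (A -> A) -> Prop) : Prop :=
  exists phi : titsT -> (V -> V),
    (forall t, inT d t -> L (phi t)) /\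
    (forall D, L D -> exists t, inT d t /\ forall v, phi t v = D v) /\
    (forall t t', inT d t -> inT d t' ->
       (forall v, phi t v = phi t' v) -> teq t t') /\
    (forall k t t', inT d t -> inT d t' ->
       forall v, phi (tlin k t t') v = k *: phi t v + phi t' v) /\
    (forall b t, inT d t -> forall v, phi (tpart b t) v = mpart p0V b (phi t) v) /\
    (forall t t', inT d t -> inT d t' ->
       forall v, phi (tbr t t') v = sbr p0V (phi t) (phi t') v).

End Tits.

(* The Cheng-Kac superalgebra J = JCK(Z, delta).                              *)
(* An element of J is a finite function 'I_8 -> Z: its coordinates on the    *)
(* free Z-basis 1, w1, w2, w3 (indices 0..3, even) and x, x1, x2, x3          *)
(* (indices 4..7, odd).                                                      *)

Section CK.
Variable F : fieldType.
Variable Z : comAlgType F.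
Variable delta : Z -> Z.

Definition JCK : lmodType F := {ffun 'I_8 -> Z}.

Definition elJ (k : nat) (h : Z) : JCK := [ffun m : 'I_8 => if val m == k then h else 0].

Definition crossx (i k : nat) (h : Z) : JCK :=
  match i, k with
  | 1, 2 => elJ 7 h | 2, 1 => elJ 7 (- h)
  | 1, 3 => elJ 6 h | 3, 1 => elJ 6 (- h)
  | 3, 2 => elJ 5 h | 2, 3 => elJ 5 (- h)
  | _, _ => 0
  end.

(* product of f e_i and g e_j, e_0..e_7 = 1,w1,w2,w3,x,x1,x2,x3,
   for i <= j in the order even/even, even/odd, odd/odd *)
Definition prodB0 (i j : nat) (f g : Z) : JCK :=
  match i, j with
  | 0, _ => elJ j (f * g)
  | 1, 0 | 2, 0 | 3, 0 => elJ i (f * g)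
  | 1, 1 | 2, 2 => elJ 0 (f * g)
  | 3, 3 => elJ 0 (- (f * g))
  | 1, 2 | 1, 3 | 2, 1 | 2, 3 | 3, 1 | 3, 2 => 0
  | 1, 4 | 2, 4 | 3, 4 => elJ (i + 4) (delta f * g)
  | 1, _ | 2, _ | 3, _ => crossx i (j - 4) (- (f * g))
  | 4, 4 => elJ 0 (delta f * g - f * delta g)
  | 4, _ => elJ (j - 4) (- (f * g))
  | _, 4 => elJ (i - 4) (f * g)
  | _, _ => 0
  end.

(* odd . even by supercommutativity *)
Definition prodB (i j : nat) (f g : Z) : JCK :=
  if (3 < i)%N && (j <= 3)%N then prodB0 j i g f else prodB0 i j f g.

Definition mulJ (u v : JCK) : JCK :=
  \sum_(i < 8) \sum_(j < 8) prodB i j (u i) (v j).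

Definition p0J (u : JCK) : JCK := [ffun m : 'I_8 => if (val m < 4)%N then u m else 0].

(* K = Z (+) Zx, coordinates 0 (on 1) and 1 (on x) *)
Definition KCK : lmodType F := {ffun 'I_2 -> Z}.

Definition embK (a : KCK) : JCK :=
  [ffun m : 'I_8 => if val m == 0%N then a ord0
                    else if val m == 4%N then a ord_max else 0].

Definition projK (u : JCK) : KCK :=
  [ffun m : 'I_2 => if val m == 0%N then u (inord 0) else u (inord 4)].

Definition mulK (a b : KCK) : KCK := projK (mulJ (embK a) (embK b)).

Definition p0K (a : KCK) : KCK := [ffun m : 'I_2 => if val m == 0%N then a m else 0].

Definition zK (f : Z) : KCK := [ffun m : 'I_2 => if val m == 0%N then f else 0].
Definition xK : KCK := [ffun m : 'I_2 => if val m == 0%N then 0 else 1].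

Definition is_eta (a : Z) (E : KCK -> KCK) : Prop :=
  is_sder mulK p0K true E /\ (forall f : Z, E (zK f) = 0) /\ E xK = zK a.

Definition is_Derbar (D : KCK -> KCK) : Prop :=
  exists (D0 E : KCK -> KCK) (a : Z),
    is_sder mulK p0K false D0 /\ is_eta a E /\ forall c, D c = D0 c + E c.

End CK.

(* Main.v *)
Require Import Defs.
From HB Require Import structures.
From mathcomp Require Import all_boot all_order all_algebra.
From mathcomp Require Import ring.
Import GRing.Theory.
Local Open Scope ring_scope.
Set Implicit Arguments. Unset Strict Implicit. Unset Printing Implicit Defensive.

(** Let [i] be a square root of [-1], and put [v1 = w1], [v2 = w2], [v3 = i w3],
    [y1 = x1], [y2 = x2], [y3 = i x3].  In this basis the product of [J] is
    invariant under rotations: [v_j v_k] is the standard scalar product,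
    [(f v)(g x) = delta f g y(v)], [v y(u) = i y(v x u)] and [x y(v) = - v].
    Identify [so_3] with 3-space acting by the vector product.  The isomorphism sends
    - [a (x) f] to the even derivation [g v |-> f g (a x v)],
      [g x |-> - i delta f g y(a)], [g y(v) |-> f g y(a x v)], zero on [Z];
    - [a (x) f x] to the inner derivation [D(f x, a)];
    - an even derivation [D] of [K], with [d = D | Z] and [D x = h x] (so that
      [d delta - delta d = 2 h delta]), to [g v |-> d g v],
      [g x |-> (d g + h g) x], [g y(v) |-> (d g - h g) y(v)];
    - [eta_e] to [- i] times the derivation [g x |-> g e], [g v |-> - g e y(v)],
      zero on [Z] and on the [y(v)].  The factor [- i] is forced by the bracket
      of [so_3 (x) Z] with [so_3 (x) Zx].
    Conversely the values of a derivation of [J] on the [w_j] and on [x] determine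
    these parameters; its values on the [x_j] follow from
    [(f w_j) x = delta f x_j] because [Z delta(Z) = Z].  Every [D(u, v)] in [J] has an
    explicit expression in this form, which gives the statement for inner
    derivations, since [Z delta(Z) = Z] also makes every [eta_e] inner. *)

(** * Derivations of a commutative algebra *)

Section Derivations.
Variables (F : fieldType) (Z : comAlgType F).

Definition is_der (d : Z -> Z) : Prop :=
  (forall (k : F) (f g : Z), d (k *: f + g) = k *: d f + d g) /\
  (forall f g : Z, d (f * g) = d f * g + f * d g).

Variables (d : Z -> Z) (der_d : is_der d).

Lemma derD f g : d (f + g) = d f + d g.
Proof. by have := der_d.1 1 f g; rewrite !scale1r. Qed.

Lemma der0 : d 0 = 0.
Proof. by apply: (addrI (d 0)); rewrite -derD !addr0. Qed.

Lemma derN f : d (- f) = - d f.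
Proof. by apply: (addrI (d f)); rewrite -derD !subrr der0. Qed.

Lemma derM f g : d (f * g) = d f * g + f * d g.
Proof. exact: der_d.2. Qed.

Lemma der1 : d 1 = 0.
Proof. by apply: (addrI (d 1)); rewrite -{3}[1]mulr1 derM mulr1 mul1r addr0. Qed.

Lemma derZ k f : d (k *: f) = k *: d f.
Proof. by rewrite -[k *: f]addr0 der_d.1 der0 addr0. Qed.

Lemma derA k : d k%:A = 0.
Proof. by rewrite derZ der1 scaler0. Qed.

Lemma derMn f n : d (f *+ n) = d f *+ n.
Proof. by elim: n => [|n IH]; rewrite ?mulr0n ?der0 // !mulrS derD IH. Qed.

Definition derE := (derD, derN, derM, derA, derMn, der1, der0).

End Derivations.

(** * Coordinates on J and K *)

Section Coordinates.
Variables (F : fieldType) (Z : comAlgType F) (delta : Z -> Z).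

(** Named coordinates turn an identity in [J] into eight identities in [Z], each within reach of
    [ring]. *)
Definition mkJ (c u1 u2 u3 s t1 t2 t3 : Z) : JCK Z :=
  [ffun m : 'I_8 => nth 0 [:: c; u1; u2; u3; s; t1; t2; t3] m].

Definition mkK (f g : Z) : KCK Z := [ffun m : 'I_2 => nth 0 [:: f; g] m].

Lemma ord8_ind (P : 'I_8 -> Prop) :
  P (@Ordinal 8 0 isT) -> P (@Ordinal 8 1 isT) -> P (@Ordinal 8 2 isT) ->
  P (@Ordinal 8 3 isT) -> P (@Ordinal 8 4 isT) -> P (@Ordinal 8 5 isT) ->
  P (@Ordinal 8 6 isT) -> P (@Ordinal 8 7 isT) -> forall m, P m.
Proof.
move=> H0 H1 H2 H3 H4 H5 H6 H7 [m lm].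
do 8 (case: m lm => [|m] lm //=; first by rewrite (bool_irrelevance lm isT)).
Qed.

Lemma ord2_ind (P : 'I_2 -> Prop) : P ord0 -> P ord_max -> forall m, P m.
Proof.
move=> H0 H1 [m lm].
have -> : Ordinal lm = if m == 0%N then ord0 else ord_max :> 'I_2.
  by apply/val_inj; case: m lm => [|[]].
by case: ifP.
Qed.

Lemma mkJ_surj (u : JCK Z) : exists c u1 u2 u3 s t1 t2 t3, u = mkJ c u1 u2 u3 s t1 t2 t3.
Proof.
exists (u (@Ordinal 8 0 isT)), (u (@Ordinal 8 1 isT)), (u (@Ordinal 8 2 isT)),
  (u (@Ordinal 8 3 isT)), (u (@Ordinal 8 4 isT)), (u (@Ordinal 8 5 isT)),
  (u (@Ordinal 8 6 isT)), (u (@Ordinal 8 7 isT)).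
by apply/ffunP; elim/ord8_ind; rewrite !ffunE.
Qed.

Lemma mkK_surj (a : KCK Z) : a = mkK (a ord0) (a ord_max).
Proof. by apply/ffunP; elim/ord2_ind; rewrite !ffunE. Qed.

Lemma mkJ_inj c u1 u2 u3 s t1 t2 t3 c' u1' u2' u3' s' t1' t2' t3' :
  mkJ c u1 u2 u3 s t1 t2 t3 = mkJ c' u1' u2' u3' s' t1' t2' t3' ->
  [/\ c = c', u1 = u1', u2 = u2' & u3 = u3'] /\ [/\ s = s', t1 = t1', t2 = t2' & t3 = t3'].
Proof.
move=> /ffunP e.
by split; split; [have := e (@Ordinal 8 0 isT) | have := e (@Ordinal 8 1 isT)
  | have := e (@Ordinal 8 2 isT) | have := e (@Ordinal 8 3 isT)
  | have := e (@Ordinal 8 4 isT) | have := e (@Ordinal 8 5 isT)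
  | have := e (@Ordinal 8 6 isT) | have := e (@Ordinal 8 7 isT)]; rewrite !ffunE.
Qed.

Lemma mkK_inj f g f' g' : mkK f g = mkK f' g' -> f = f' /\ g = g'.
Proof.
by move=> /ffunP e; split; [have := e ord0 | have := e ord_max]; rewrite !ffunE.
Qed.

Lemma mkK0E f g : mkK f g ord0 = f. Proof. by rewrite ffunE. Qed.
Lemma mkK1E f g : mkK f g ord_max = g. Proof. by rewrite ffunE. Qed.

Lemma mkJ_add c u1 u2 u3 s t1 t2 t3 c' u1' u2' u3' s' t1' t2' t3' :
  mkJ c u1 u2 u3 s t1 t2 t3 + mkJ c' u1' u2' u3' s' t1' t2' t3' =
  mkJ (c + c') (u1 + u1') (u2 + u2') (u3 + u3') (s + s') (t1 + t1') (t2 + t2') (t3 + t3').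
Proof. by apply/ffunP; elim/ord8_ind; rewrite !ffunE. Qed.

Lemma mkJ_opp c u1 u2 u3 s t1 t2 t3 :
  - mkJ c u1 u2 u3 s t1 t2 t3 = mkJ (- c) (- u1) (- u2) (- u3) (- s) (- t1) (- t2) (- t3).
Proof. by apply/ffunP; elim/ord8_ind; rewrite !ffunE. Qed.

(** Scalars enter as elements [k%:A] of [Z], so that coordinates remain ring expressions. *)
Lemma mkJ_scale k c u1 u2 u3 s t1 t2 t3 :
  k *: mkJ c u1 u2 u3 s t1 t2 t3 =
  mkJ (k%:A * c) (k%:A * u1) (k%:A * u2) (k%:A * u3)
      (k%:A * s) (k%:A * t1) (k%:A * t2) (k%:A * t3).
Proof. by apply/ffunP; elim/ord8_ind; rewrite !ffunE /= mulr_algl. Qed.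

Lemma mkJ_0 : 0 = mkJ 0 0 0 0 0 0 0 0.
Proof. by apply/ffunP; elim/ord8_ind; rewrite !ffunE. Qed.

Lemma mkK_add f g f' g' : mkK f g + mkK f' g' = mkK (f + f') (g + g').
Proof. by apply/ffunP; elim/ord2_ind; rewrite !ffunE. Qed.

Lemma mkK_opp f g : - mkK f g = mkK (- f) (- g).
Proof. by apply/ffunP; elim/ord2_ind; rewrite !ffunE. Qed.

Lemma mkK_scale k f g : k *: mkK f g = mkK (k%:A * f) (k%:A * g).
Proof. by apply/ffunP; elim/ord2_ind; rewrite !ffunE /= mulr_algl. Qed.

Lemma mkK_0 : 0 = mkK 0 0.
Proof. by apply/ffunP; elim/ord2_ind; rewrite !ffunE. Qed.

Lemma zK_mk f : zK f = mkK f 0.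
Proof. by apply/ffunP; elim/ord2_ind; rewrite !ffunE. Qed.

Lemma xK_mk : xK Z = mkK 0 1.
Proof. by apply/ffunP; elim/ord2_ind; rewrite !ffunE. Qed.

Lemma p0K_mk f g : p0K (mkK f g) = mkK f 0.
Proof. by apply/ffunP; elim/ord2_ind; rewrite !ffunE. Qed.

Lemma p0J_mk c u1 u2 u3 s t1 t2 t3 :
  p0J (mkJ c u1 u2 u3 s t1 t2 t3) = mkJ c u1 u2 u3 0 0 0 0.
Proof. by apply/ffunP; elim/ord8_ind; rewrite !ffunE. Qed.

Lemma embK_mk f g : embK (mkK f g) = mkJ f 0 0 0 g 0 0 0.
Proof. by apply/ffunP; elim/ord8_ind; rewrite !ffunE. Qed.

Lemma projK_mk c u1 u2 u3 s t1 t2 t3 : projK (mkJ c u1 u2 u3 s t1 t2 t3) = mkK c s.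
Proof. by apply/ffunP; elim/ord2_ind; rewrite !ffunE /= inordK. Qed.

Lemma elJ_mk h :
  (elJ 0 h = mkJ h 0 0 0 0 0 0 0) * (elJ 1 h = mkJ 0 h 0 0 0 0 0 0) *
  (elJ 2 h = mkJ 0 0 h 0 0 0 0 0) * (elJ 3 h = mkJ 0 0 0 h 0 0 0 0) *
  (elJ 4 h = mkJ 0 0 0 0 h 0 0 0) * (elJ 5 h = mkJ 0 0 0 0 0 h 0 0) *
  (elJ 6 h = mkJ 0 0 0 0 0 0 h 0) * (elJ 7 h = mkJ 0 0 0 0 0 0 0 h).
Proof. by do !split; apply/ffunP; elim/ord8_ind; rewrite !ffunE. Qed.

(** All sixty-four products of basis vectors are evaluated once and collected; later computations
    use the product of [J] only through this formula. *)
Lemma mulJ_mk c u1 u2 u3 s t1 t2 t3 c' u1' u2' u3' s' t1' t2' t3' :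
  mulJ delta (mkJ c u1 u2 u3 s t1 t2 t3) (mkJ c' u1' u2' u3' s' t1' t2' t3') =
  mkJ (c * c' + u1 * u1' + u2 * u2' - u3 * u3' + (delta s * s' - s * delta s'))
    (c * u1' + u1 * c' - s * t1' + t1 * s')
    (c * u2' + u2 * c' - s * t2' + t2 * s')
    (c * u3' + u3 * c' - s * t3' + t3 * s')
    (c * s' + s * c')
    (c * t1' + t1 * c' + delta u1 * s' + delta u1' * s
       + (u2 * t3' + u2' * t3) - (u3 * t2' + u3' * t2))
    (c * t2' + t2 * c' + delta u2 * s' + delta u2' * s
       - (u1 * t3' + u1' * t3) + (u3 * t1' + u3' * t1))
    (c * t3' + t3 * c' + delta u3 * s' + delta u3' * s
       - (u1 * t2' + u1' * t2) + (u2 * t1' + u2' * t1)).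
Proof.
rewrite /mulJ !big_ord_recl !big_ord0 /= /prodB /= !ffunE /=.
rewrite !elJ_mk !(addr0, add0r).
rewrite !mkJ_add.
congr mkJ; ring.
Qed.

Lemma mulK_mk f g f' g' :
  mulK delta (mkK f g) (mkK f' g') =
  mkK (f * f' + (delta g * g' - g * delta g')) (f * g' + g * f').
Proof. by rewrite /mulK !embK_mk mulJ_mk projK_mk; congr mkK; ring. Qed.

Lemma homJ0P (u : JCK Z) :
  Defs.hom (p0J (Z:=Z)) false u <-> exists c u1 u2 u3, u = mkJ c u1 u2 u3 0 0 0 0.
Proof.
split=> [|[c [u1 [u2 [u3 ->]]]]]; last by rewrite /Defs.hom /part p0J_mk.
have [c [u1 [u2 [u3 [s [t1 [t2 [t3 ->]]]]]]]] := mkJ_surj u.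
by rewrite /Defs.hom /part p0J_mk => <-; exists c, u1, u2, u3.
Qed.

Lemma homJ1P (u : JCK Z) :
  Defs.hom (p0J (Z:=Z)) true u <-> exists s t1 t2 t3, u = mkJ 0 0 0 0 s t1 t2 t3.
Proof.
split=> [|[s [t1 [t2 [t3 ->]]]]]; last first.
  by rewrite /Defs.hom /part p0J_mk mkJ_opp mkJ_add !subr0.
have [c [u1 [u2 [u3 [s [t1 [t2 [t3 ->]]]]]]]] := mkJ_surj u.
rewrite /Defs.hom /part p0J_mk mkJ_opp mkJ_add !subrr !subr0 => <-.
by exists s, t1, t2, t3.
Qed.

Lemma homK0P (a : KCK Z) :
  Defs.hom (p0K (Z:=Z)) false a <-> exists f, a = mkK f 0.
Proof.
split=> [|[f ->]]; last by rewrite /Defs.hom /part p0K_mk.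
by rewrite /Defs.hom /part (mkK_surj a) p0K_mk => <-; exists (a ord0).
Qed.

Lemma homK1P (a : KCK Z) :
  Defs.hom (p0K (Z:=Z)) true a <-> exists g, a = mkK 0 g.
Proof.
split=> [|[g ->]]; last by rewrite /Defs.hom /part p0K_mk mkK_opp mkK_add !subr0.
rewrite /Defs.hom /part (mkK_surj a) p0K_mk mkK_opp mkK_add subrr subr0 => <-.
by exists (a ord_max).
Qed.

Definition mkJE := (mkJ_add, mkJ_opp, mkJ_scale, p0J_mk, mulJ_mk).
Definition mkKE := (mkK_add, mkK_opp, mkK_scale, p0K_mk, mulK_mk).

End Coordinates.

(** * Sums over three indices and over parities *)

Local Notation o0 := (@Ordinal 3 0 isT).
Local Notation o1 := (@Ordinal 3 1 isT).
Local Notation o2 := (@Ordinal 3 2 isT).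

Section Ord3.

Lemma ord3_ind (P : 'I_3 -> Prop) : P o0 -> P o1 -> P o2 -> forall m, P m.
Proof.
move=> H0 H1 H2 [m lm].
do 3 (case: m lm => [|m] lm //=; first by rewrite (bool_irrelevance lm isT)).
Qed.

Lemma sum3 (V : nmodType) (f : 'I_3 -> V) : \sum_(m < 3) f m = f o0 + f o1 + f o2.
Proof.
rewrite !big_ord_recl big_ord0 addr0 addrA.
by congr (f _ + f _ + f _); apply/val_inj.
Qed.

Lemma sum_bool (V : nmodType) (f : bool -> V) :
  \sum_(b <- [:: false; true]) f b = f false + f true.
Proof. by rewrite !big_cons big_nil addr0. Qed.

Lemma sum_bool2 (V : nmodType) (f : bool -> bool -> V) :
  \sum_(b <- [:: false; true]) \sum_(c <- [:: false; true]) f b c =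
  f false false + f false true + (f true false + f true true).
Proof. by rewrite sum_bool; congr (_ + _); rewrite sum_bool. Qed.

Lemma skew_diag (F : fieldType) (V : lmodType F) (X : 'I_3 -> 'I_3 -> V) m :
  (2%:R : F) != 0 -> Defs.skew X -> X m m = 0.
Proof.
move=> n2 sX; have : (2%:R : F) *: X m m = 0.
  by rewrite scaler_nat mulr2n {1}(sX m m) addNr.
by move/eqP; rewrite scaler_eq0 (negPf n2) => /eqP.
Qed.

End Ord3.

(** * Super operators expanded by parity *)

Section ParityExpansion.
Variables (F : fieldType) (V : lmodType F) (mul : V -> V -> V) (p0 : V -> V).

(** Only the odd-odd term changes sign: a super commutator is three commutators plus one
    anticommutator. *)
Lemma sum_sgn (f g : bool -> bool -> V) :
  \sum_(b <- [:: false; true]) \sum_(c <- [:: false; true]) (f b c - sgn F (b && c) *: g b c) =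
  (f false false - g false false) + (f false true - g false true)
  + ((f true false - g true false) + (f true true + g true true)).
Proof. by rewrite sum_bool2 /sgn /= !scale1r scaleN1r opprK. Qed.

Lemma DopE a b c : Dop mul p0 a b c =
  (mul (p0 a) (mul (p0 b) c) - mul (p0 b) (mul (p0 a) c))
  + (mul (p0 a) (mul (b - p0 b) c) - mul (b - p0 b) (mul (p0 a) c))
  + ((mul (a - p0 a) (mul (p0 b) c) - mul (p0 b) (mul (a - p0 a) c))
     + (mul (a - p0 a) (mul (b - p0 b) c) + mul (b - p0 b) (mul (a - p0 a) c))).
Proof. by rewrite /Dop sum_sgn. Qed.

Lemma sbrE D E v : sbr p0 D E v =
  (mpart p0 false D (mpart p0 false E v) - mpart p0 false E (mpart p0 false D v))
  + (mpart p0 false D (mpart p0 true E v) - mpart p0 true E (mpart p0 false D v))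
  + ((mpart p0 true D (mpart p0 false E v) - mpart p0 false E (mpart p0 true D v))
     + (mpart p0 true D (mpart p0 true E v) + mpart p0 true E (mpart p0 true D v))).
Proof. by rewrite /sbr sum_sgn. Qed.

Lemma tbr1E (t t' : titsT V) j k : (tbr mul p0 t t').1 j k =
  \sum_(m < 3) (mul (t.1 j m) (t'.1 m k) - mul (t.1 m k) (t'.1 j m)) + t.2 (t'.1 j k)
  - (mpart p0 false t'.2 (p0 (t.1 j k)) + mpart p0 true t'.2 (p0 (t.1 j k))
     + (mpart p0 false t'.2 (t.1 j k - p0 (t.1 j k))
        - mpart p0 true t'.2 (t.1 j k - p0 (t.1 j k)))).
Proof. by rewrite /= sum_bool2 /sgn /= !scale1r scaleN1r. Qed.

Lemma tbr2E (t t' : titsT V) a : (tbr mul p0 t t').2 a =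
  sbr p0 t.2 t'.2 a + (2%:R : F)^-1 *:
   (Dop mul p0 (t.1 o0 o0) (t'.1 o0 o0) a + Dop mul p0 (t.1 o0 o1) (t'.1 o1 o0) a
      + Dop mul p0 (t.1 o0 o2) (t'.1 o2 o0) a
    + (Dop mul p0 (t.1 o1 o0) (t'.1 o0 o1) a + Dop mul p0 (t.1 o1 o1) (t'.1 o1 o1) a
      + Dop mul p0 (t.1 o1 o2) (t'.1 o2 o1) a)
    + (Dop mul p0 (t.1 o2 o0) (t'.1 o0 o2) a + Dop mul p0 (t.1 o2 o1) (t'.1 o1 o2) a
      + Dop mul p0 (t.1 o2 o2) (t'.1 o2 o2) a)).
Proof. by rewrite /= sum3; congr (_ + _ *: (_ + _ + _)); rewrite sum3. Qed.

End ParityExpansion.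

(** * Closure properties and induction for inner derivations *)

Section InnerGeneric.
Variables (F : fieldType) (V : lmodType F) (mul : V -> V -> V) (p0 : V -> V).
Notation Inder := (is_Inder mul p0).

Lemma Inder_ext f g : (forall c, f c = g c) -> Inder f -> Inder g.
Proof. by move=> fg [s E]; exists s => c; rewrite -fg E. Qed.

Lemma Inder_Dop a b : Inder (Dop mul p0 a b).
Proof. by exists [:: (1, a, b)] => c; rewrite big_seq1 scale1r. Qed.

Lemma Inder_lin k f g : Inder f -> Inder g -> Inder (fun c => k *: f c + g c).
Proof.
move=> [s Es] [s' Es']; exists ([seq (k * t.1.1, t.1.2, t.2) | t <- s] ++ s') => c.
rewrite big_cat big_map /= Es Es'; congr (_ + _).
by rewrite scaler_sumr; apply: eq_bigr => t _; rewrite scalerA.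
Qed.

Lemma Inder_add f g : Inder f -> Inder g -> Inder (fun c => f c + g c).
Proof.
move=> If Ig; apply: (Inder_ext _ (Inder_lin 1 If Ig)) => c.
by rewrite scale1r.
Qed.

(** Induction on the list of summands. [is_Inder] fixes a map only pointwise, hence the first
    premise: [P] must respect pointwise equality. *)
Lemma Inder_ind (P : (V -> V) -> Prop) :
  (forall f g, (forall c, f c = g c) -> P f -> P g) ->
  P (fun=> 0) ->
  (forall k a b f, Inder f -> P f -> P (fun c => k *: Dop mul p0 a b c + f c)) ->
  forall f, Inder f -> P f.
Proof.
move=> Pext P0 PS f [s Es].
apply: (Pext (fun c => \sum_(t <- s) t.1.1 *: Dop mul p0 t.1.2 t.2 c)) => [c|].
  by rewrite Es.
elim: s {f Es} => [|[[k a] b] s IH].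
  by apply: (Pext _ _ _ P0) => c; rewrite big_nil.
apply: (Pext _ _ _ (PS k a b _ _ IH)) => [c|]; first by rewrite big_cons.
by exists s.
Qed.

End InnerGeneric.

(** * The isomorphism *)

Section Model.
Variables (F : fieldType) (Z : comAlgType F) (delta : Z -> Z) (i : F).
Hypothesis der_delta : is_der delta.
Hypothesis ii : i * i = -1.

(** The square root of -1 is moved into [Z] so that [ring: iZ2] can reduce its powers. *)
Definition iZ : Z := i%:A.

Lemma iZ2 : iZ * iZ = -1.
Proof. by rewrite /iZ -scalerAl mul1r scalerA ii scaleN1r. Qed.

Lemma der_iZ d : is_der d -> d iZ = 0.
Proof. by move=> dd; apply: derA. Qed.

(* The images of [a (x) Z] and of the even derivation of [K] given by [d] and [h]
   ([evJ]), and of [b (x) Zx] and [eta_e] ([odJ]).  The coordinates on [w3], [x3]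
   are [i] times those on [v3], [y3], which explains the asymmetric factors [iZ]. *)
Definition evJ (a1 a2 a3 : Z) (d : Z -> Z) (h : Z) (u : JCK Z) : JCK Z :=
  let c := u (@Ordinal 8 0 isT) in let u1 := u (@Ordinal 8 1 isT) in
  let u2 := u (@Ordinal 8 2 isT) in let u3 := u (@Ordinal 8 3 isT) in
  let s := u (@Ordinal 8 4 isT) in let t1 := u (@Ordinal 8 5 isT) in
  let t2 := u (@Ordinal 8 6 isT) in let t3 := u (@Ordinal 8 7 isT) in
  mkJ (d c)
    (d u1 - iZ * a2 * u3 - a3 * u2)
    (d u2 + a3 * u1 + iZ * a1 * u3)
    (d u3 + iZ * (a1 * u2 - a2 * u1))
    (d s + h * s)
    (d t1 - h * t1 - iZ * delta a1 * s - iZ * a2 * t3 - a3 * t2)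
    (d t2 - h * t2 - iZ * delta a2 * s + a3 * t1 + iZ * a1 * t3)
    (d t3 - h * t3 + delta a3 * s + iZ * (a1 * t2 - a2 * t1)).

Definition odJ (b1 b2 b3 e : Z) (u : JCK Z) : JCK Z :=
  let c := u (@Ordinal 8 0 isT) in let u1 := u (@Ordinal 8 1 isT) in
  let u2 := u (@Ordinal 8 2 isT) in let u3 := u (@Ordinal 8 3 isT) in
  let s := u (@Ordinal 8 4 isT) in let t1 := u (@Ordinal 8 5 isT) in
  let t2 := u (@Ordinal 8 6 isT) in let t3 := u (@Ordinal 8 7 isT) in
  mkJ (b1 * t1 + b2 * t2 - iZ * b3 * t3 - iZ * e * s)
    (b1 * delta s - delta b1 * s - b2 * t3 + iZ * b3 * t2)
    (b2 * delta s - delta b2 * s + b1 * t3 - iZ * b3 * t1)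
    (iZ * (b3 * delta s - delta b3 * s) + b1 * t2 - b2 * t1)
    (b1 * u1 + b2 * u2 - iZ * b3 * u3)
    (b1 * delta c - b2 * delta u3 + iZ * b3 * delta u2 + iZ * e * u1)
    (b2 * delta c + b1 * delta u3 - iZ * b3 * delta u1 + iZ * e * u2)
    (iZ * b3 * delta c + b1 * delta u2 - b2 * delta u1 + iZ * e * u3).

Lemma evJ_mk a1 a2 a3 d h c u1 u2 u3 s t1 t2 t3 :
  evJ a1 a2 a3 d h (mkJ c u1 u2 u3 s t1 t2 t3) =
  mkJ (d c)
    (d u1 - iZ * a2 * u3 - a3 * u2)
    (d u2 + a3 * u1 + iZ * a1 * u3)
    (d u3 + iZ * (a1 * u2 - a2 * u1))
    (d s + h * s)
    (d t1 - h * t1 - iZ * delta a1 * s - iZ * a2 * t3 - a3 * t2)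
    (d t2 - h * t2 - iZ * delta a2 * s + a3 * t1 + iZ * a1 * t3)
    (d t3 - h * t3 + delta a3 * s + iZ * (a1 * t2 - a2 * t1)).
Proof. by rewrite /evJ !ffunE. Qed.

Lemma odJ_mk b1 b2 b3 e c u1 u2 u3 s t1 t2 t3 :
  odJ b1 b2 b3 e (mkJ c u1 u2 u3 s t1 t2 t3) =
  mkJ (b1 * t1 + b2 * t2 - iZ * b3 * t3 - iZ * e * s)
    (b1 * delta s - delta b1 * s - b2 * t3 + iZ * b3 * t2)
    (b2 * delta s - delta b2 * s + b1 * t3 - iZ * b3 * t1)
    (iZ * (b3 * delta s - delta b3 * s) + b1 * t2 - b2 * t1)
    (b1 * u1 + b2 * u2 - iZ * b3 * u3)
    (b1 * delta c - b2 * delta u3 + iZ * b3 * delta u2 + iZ * e * u1)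
    (b2 * delta c + b1 * delta u3 - iZ * b3 * delta u1 + iZ * e * u2)
    (iZ * b3 * delta c + b1 * delta u2 - b2 * delta u1 + iZ * e * u3).
Proof. by rewrite /odJ !ffunE. Qed.

(** These pairs parametrize the even derivations of [K]. The commutation rule results from
    differentiating [(f x) x = delta f] when [x] goes to [h x]. *)
Definition kder (d : Z -> Z) (h : Z) : Prop :=
  is_der d /\ forall f, d (delta f) = delta (d f) + 2 * h * delta f.

(** The parameters bracket as in the semidirect product of so_3 (x) Z with the even derivations of
    [K]: the vector product of [a] and [a'], the actions of [d] and [d'] on them, and the commutator
    of the two derivations of [K]. *)
Lemma evJ_evJ_comm a1 a2 a3 d h a1' a2' a3' d' h' u :
  kder d h -> kder d' h' ->
  evJ a1 a2 a3 d h (evJ a1' a2' a3' d' h' u) - evJ a1' a2' a3' d' h' (evJ a1 a2 a3 d h u) =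
  evJ (a2 * a3' - a3 * a2' + d a1' - d' a1)
      (a3 * a1' - a1 * a3' + d a2' - d' a2)
      (a1 * a2' - a2 * a1' + d a3' - d' a3)
      (fun f => d (d' f) - d' (d f)) (d h' - d' h) u.
Proof.
move=> [dd dh] [dd' dh'].
have [c [u1 [u2 [u3 [s [t1 [t2 [t3 ->]]]]]]]] := mkJ_surj u.
rewrite !evJ_mk !mkJE.
congr mkJ; rewrite ?(derE dd, derE dd', derE der_delta, dh, dh');
  rewrite ?(der_iZ dd, der_iZ dd', der_iZ der_delta); ring: iZ2.
Qed.

(** The vector part is [a x b] plus the action [d b + h b] on Zx. In the last parameter, [d e - h e]
    is the bracket with eta_e, and the sum of the [b_j * delta a_j] is the trace term, as D(f, g x)
    is eta of [g * delta f]. *)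
Lemma evJ_odJ_comm a1 a2 a3 d h b1 b2 b3 e u :
  kder d h ->
  evJ a1 a2 a3 d h (odJ b1 b2 b3 e u) - odJ b1 b2 b3 e (evJ a1 a2 a3 d h u) =
  odJ (a2 * b3 - a3 * b2 + d b1 + h * b1)
      (a3 * b1 - a1 * b3 + d b2 + h * b2)
      (a1 * b2 - a2 * b1 + d b3 + h * b3)
      (d e - h * e - (b1 * delta a1 + b2 * delta a2 + b3 * delta a3)) u.
Proof.
move=> [dd dh].
have [c [u1 [u2 [u3 [s [t1 [t2 [t3 ->]]]]]]]] := mkJ_surj u.
rewrite !(evJ_mk, odJ_mk) !mkJE.
congr mkJ; rewrite ?(derE dd, derE der_delta, dh, der_iZ dd, der_iZ der_delta); ring: iZ2.
Qed.

(** The vector part is a vector product formed with [(f x)(g x) = delta f g - f delta g], plus the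
    actions of eta_e and eta_e'. The scalar product of [b] and [b'] comes from the trace term D(f x,
    g x). *)
Lemma odJ_odJ_comm b1 b2 b3 e b1' b2' b3' e' u :
  odJ b1 b2 b3 e (odJ b1' b2' b3' e' u) + odJ b1' b2' b3' e' (odJ b1 b2 b3 e u) =
  evJ (delta b2 * b3' - b2 * delta b3' - (delta b3 * b2' - b3 * delta b2') + b1' * e + b1 * e')
      (delta b3 * b1' - b3 * delta b1' - (delta b1 * b3' - b1 * delta b3') + b2' * e + b2 * e')
      (delta b1 * b2' - b1 * delta b2' - (delta b2 * b1' - b2 * delta b1') + b3' * e + b3 * e')
      (fun f => 2 * (b1 * b1' + b2 * b2' + b3 * b3') * delta f)
      (- delta (b1 * b1' + b2 * b2' + b3 * b3')) u.
Proof.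
have [c [u1 [u2 [u3 [s [t1 [t2 [t3 ->]]]]]]]] := mkJ_surj u.
rewrite !(evJ_mk, odJ_mk) !mkJE.
congr mkJ; rewrite ?(derE der_delta, der_iZ der_delta); ring: iZ2.
Qed.

Lemma evJ_sder a1 a2 a3 d h : kder d h ->
  is_sder (mulJ delta) (p0J (Z:=Z)) false (evJ a1 a2 a3 d h).
Proof.
move=> [dd dh]; split; last split.
- move=> k u v.
  have [c [u1 [u2 [u3 [s [t1 [t2 [t3 ->]]]]]]]] := mkJ_surj u.
  have [c' [u1' [u2' [u3' [s' [t1' [t2' [t3' ->]]]]]]]] := mkJ_surj v.
  rewrite !(evJ_mk, mkJE).
  by congr mkJ; rewrite ?(derE dd); ring.
- move=> [] v => [/homJ1P [s [t1 [t2 [t3 ->]]]] | /homJ0P [c [u1 [u2 [u3 ->]]]]] /=.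
  + apply/homJ1P; rewrite evJ_mk !(der0 dd) !(mulr0, mul0r, addr0, subr0).
    by do 4 eexists; reflexivity.
  + apply/homJ0P; rewrite evJ_mk !(der0 dd) !(mulr0, mul0r, addr0, subr0).
    by do 4 eexists; reflexivity.
- move=> p q u v _ _; rewrite /sgn /= scale1r.
  have [c [u1 [u2 [u3 [s [t1 [t2 [t3 ->]]]]]]]] := mkJ_surj u.
  have [c' [u1' [u2' [u3' [s' [t1' [t2' [t3' ->]]]]]]]] := mkJ_surj v.
  rewrite !(evJ_mk, mkJE).
  congr mkJ; rewrite ?(derE dd, derE der_delta, dh, der_iZ dd, der_iZ der_delta); ring: iZ2.
Qed.

Lemma odJ_sder b1 b2 b3 e :
  is_sder (mulJ delta) (p0J (Z:=Z)) true (odJ b1 b2 b3 e).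
Proof.
have dd := der_delta; split; last split.
- move=> k u v.
  have [c [u1 [u2 [u3 [s [t1 [t2 [t3 ->]]]]]]]] := mkJ_surj u.
  have [c' [u1' [u2' [u3' [s' [t1' [t2' [t3' ->]]]]]]]] := mkJ_surj v.
  rewrite !(odJ_mk, mkJE).
  by congr mkJ; rewrite ?(derE dd); ring.
- move=> [] v => [/homJ1P [s [t1 [t2 [t3 ->]]]] | /homJ0P [c [u1 [u2 [u3 ->]]]]] /=.
  + apply/homJ0P; rewrite odJ_mk !(der0 dd) !(mulr0, mul0r, addr0, subr0).
    by do 4 eexists; reflexivity.
  + apply/homJ1P; rewrite odJ_mk !(der0 dd) !(mulr0, mul0r, addr0, subr0).
    by do 4 eexists; reflexivity.
(* The sign is governed by the parity of the first factor, hence the case split on [u] alone. *)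
- move=> [] q u v => [/homJ1P [s [t1 [t2 [t3 ->]]]] | /homJ0P [c [u1 [u2 [u3 ->]]]]] _ /=;
  have [c' [u1' [u2' [u3' [s' [t1' [t2' [t3' ->]]]]]]]] := mkJ_surj v;
  rewrite /sgn ?scale1r ?scaleN1r !(odJ_mk, mkJE);
  congr mkJ; rewrite ?(derE dd, der_iZ dd); ring: iZ2.
Qed.

(** * The derivations of [K] in terms of parameters *)

Hypothesis char2 : (2%:R : F) != 0.

Notation p0J := (p0J (Z:=Z)).
Notation p0K := (p0K (Z:=Z)).
Notation mulJ := (mulJ delta).
Notation mulK := (mulK delta).

(** For [kder d h] this is the general element of the extended even derivations of [K]: the even
    derivation given by [d] and [h], plus eta_e. *)
Definition derK (d : Z -> Z) (h e : Z) (a : KCK Z) : KCK Z :=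
  mkK (d (a ord0) + e * a ord_max) (d (a ord_max) + h * a ord_max).

Lemma derK_mk d h e f g : derK d h e (mkK f g) = mkK (d f + e * g) (d g + h * g).
Proof. by rewrite /derK mkK0E mkK1E. Qed.

Lemma is_lin_add (V : lmodType F) (f : V -> V) u v : is_lin f -> f (u + v) = f u + f v.
Proof. by move=> lf; have := lf 1 u v; rewrite !scale1r. Qed.

(** [d] is the restriction to [Z] and [h] the coefficient of the image of [x]; the product of [g]
    and [x] then determines the image of [g x]. *)
Lemma sder0K_P D : is_sder mulK p0K false D ->
  exists d h, kder d h /\ forall a, D a = derK d h 0 a.
Proof.
move=> [lD [hD mD]].
pose d f := D (mkK f 0) ord0; pose h := D (mkK 0 1) ord_max.
have DZ f : D (mkK f 0) = mkK (d f) 0.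
  have /homK0P [g eg] : Defs.hom p0K false (D (mkK f 0)).
    by apply: (hD false); apply/homK0P; exists f.
  by rewrite /d eg mkK0E.
have Dx : D (mkK 0 1) = mkK 0 h.
  have /homK1P [g eg] : Defs.hom p0K true (D (mkK 0 1)).
    by apply: (hD true); apply/homK1P; exists 1.
  by rewrite /h eg mkK1E.
have mDE p q u v : Defs.hom p0K p u -> Defs.hom p0K q v ->
    D (mulK u v) = mulK (D u) v + mulK u (D v).
  by move=> hu hv; rewrite (mD p q) //= scale1r.
have hZ f : Defs.hom p0K false (mkK f 0) by apply/homK0P; exists f.
have hx f : Defs.hom p0K true (mkK 0 f) by apply/homK1P; exists f.
have dd : is_der d.
  split=> [k f g|f g].
    have : D (k *: mkK f 0 + mkK g 0) = k *: D (mkK f 0) + D (mkK g 0) by rewrite lD.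
    rewrite !mkKE mulr0 addr0 !DZ !mkKE => /mkK_inj [].
    by rewrite !mulr_algl.
  have := mDE false false _ _ (hZ f) (hZ g).
  rewrite !DZ !mkKE !(oppr0, mulr0, mul0r, addr0, subr0) DZ => /mkK_inj [-> _].
  by [].
have Dgx g : D (mkK 0 g) = mkK 0 (d g + h * g).
  have := mDE false true _ _ (hZ g) (hx 1).
  rewrite DZ Dx !mkKE !(oppr0, der0 der_delta, mulr0, mul0r, addr0, subr0, mulr1, add0r) => ->.
  by congr mkK; ring.
exists d, h; split.
  (* The commutation rule comes from [(f x) x = delta f]. *)
  split=> // f; have := mDE true true _ _ (hx f) (hx 1).
  rewrite Dgx Dx !mkKE !(derE der_delta).
  rewrite !(oppr0, mulr0, mul0r, addr0, subr0, mulr1, add0r) DZ => /mkK_inj [-> _].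
  ring.
move=> a; rewrite (mkK_surj a) derK_mk.
have -> : mkK (a ord0) (a ord_max) = mkK (a ord0) 0 + mkK 0 (a ord_max) by rewrite mkKE addr0 add0r.
by rewrite is_lin_add // DZ Dgx mkKE mul0r addr0 add0r.
Qed.

Lemma eta_P e E : is_eta delta e E -> forall a, E a = derK (fun=> 0) 0 e a.
Proof.
move=> [[lE [hE mE]] [EZ Ex]] a; rewrite (mkK_surj a).
have EZm f : E (mkK f 0) = 0 by rewrite -zK_mk.
(* Writing [g x] as a product with [x] reduces everything to the prescribed values on [Z] and at
   [x]. *)
have -> : mkK (a ord0) (a ord_max) = mkK (a ord0) 0 + mulK (mkK (a ord_max) 0) (mkK 0 1).
  by rewrite !mkKE !(derE der_delta); congr mkK; ring.
rewrite is_lin_add // (mE false true).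
- rewrite /= scale1r !EZm -xK_mk Ex zK_mk xK_mk mkK_0 !mkKE derK_mk.
  by rewrite !(derE der_delta); congr mkK; ring.
- by apply/homK0P; exists (a ord_max).
- by apply/homK1P; exists 1.
Qed.

Lemma Derbar_P D : is_Derbar delta D <->
  exists d h e, kder d h /\ forall a, D a = derK d h e a.
Proof.
split=> [[D0 [E [e [/sder0K_P [d [h [kd eD0]]] [/eta_P eE eD]]]]] | [d [h [e [kd eD]]]]].
  exists d, h, e; split=> // a.
  by rewrite eD eD0 eE mkKE; congr mkK; ring.
have [dd dh] := kd.
exists (derK d h 0), (derK (fun=> 0) 0 e), e; split; last split; last first.
- by move=> a; rewrite eD mkKE; congr mkK; ring.
- split; last first.
    split=> [f|]; rewrite ?xK_mk ?zK_mk ?mkK_0 derK_mk; congr mkK; ring.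
  split; last split.
  + by move=> k u v; rewrite (mkK_surj u) (mkK_surj v) !(derK_mk, mkKE); congr mkK; ring.
  + move=> [] v => [/homK1P [g ->] | /homK0P [g ->]] /=.
      by apply/homK0P; rewrite derK_mk !mul0r !addr0; eexists; reflexivity.
    by apply/homK1P; rewrite derK_mk !mulr0 !addr0; eexists; reflexivity.
  + move=> [] q u v => [/homK1P [g ->] | /homK0P [g ->]] _ /=;
    rewrite (mkK_surj v) /sgn ?scale1r ?scaleN1r !(derK_mk, mkKE) !(derE der_delta);
    congr mkK; ring.
- split; last split.
  + move=> k u v; rewrite (mkK_surj u) (mkK_surj v) !(derK_mk, mkKE) !(derE dd).
    by congr mkK; ring.
  + move=> [] v => [/homK1P [g ->] | /homK0P [g ->]] /=.
      by apply/homK1P; rewrite derK_mk (der0 dd) !mul0r !addr0; eexists; reflexivity.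
    by apply/homK0P; rewrite derK_mk (der0 dd) !mulr0 !addr0; eexists; reflexivity.
  + move=> p q u v _ _.
    rewrite (mkK_surj u) (mkK_surj v) /sgn /= scale1r !(derK_mk, mkKE).
    rewrite !(derE dd, derE der_delta, dh).
    by congr mkK; ring.
Qed.

(* A skew matrix is the vector product with [a] when its entries (2,1), (0,2),
   (1,0), counted from 0, are [a1], [a2], [a3]. *)
Definition phi (t : titsT (KCK Z)) (u : JCK Z) : JCK Z :=
  evJ (t.1 o2 o1 ord0) (t.1 o0 o2 ord0) (t.1 o1 o0 ord0)
      (fun f => t.2 (zK f) ord0) (t.2 (xK Z) ord_max) u
  + odJ (t.1 o2 o1 ord_max) (t.1 o0 o2 ord_max) (t.1 o1 o0 ord_max) (t.2 (xK Z) ord0) u.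

Lemma eq_evJ a1 a2 a3 d d' h u : d =1 d' -> evJ a1 a2 a3 d h u = evJ a1 a2 a3 d' h u.
Proof. by move=> e; rewrite /evJ !e. Qed.

(** The terms [d 0] and [d 1] appear when [t.2] is evaluated at [x], whose coordinates are 0 and
    1. *)
Lemma phiE t a1 a2 a3 b1 b2 b3 d h e u :
  t.1 o2 o1 = mkK a1 b1 -> t.1 o0 o2 = mkK a2 b2 -> t.1 o1 o0 = mkK a3 b3 ->
  d 0 = 0 -> d 1 = 0 -> (forall a, t.2 a = derK d h e a) ->
  phi t u = evJ a1 a2 a3 d h u + odJ b1 b2 b3 e u.
Proof.
move=> e1 e2 e3 d0 d1 eD.
rewrite /phi e1 e2 e3 !(mkK0E, mkK1E) !eD xK_mk derK_mk !(mkK0E, mkK1E) d0 d1 !mulr1 !add0r.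
by congr (_ + _); apply: eq_evJ => f; rewrite eD zK_mk derK_mk mkK0E mulr0 addr0.
Qed.

Lemma inT_P t : inT (is_Derbar delta) t ->
  exists a1 a2 a3 b1 b2 b3 d h e,
    [/\ Defs.skew t.1, t.1 o2 o1 = mkK a1 b1, t.1 o0 o2 = mkK a2 b2 & t.1 o1 o0 = mkK a3 b3]
    /\ kder d h /\ (forall a, t.2 a = derK d h e a).
Proof.
move=> [sX /Derbar_P [d [h [e [kd eD]]]]].
exists (t.1 o2 o1 ord0), (t.1 o0 o2 ord0), (t.1 o1 o0 ord0),
  (t.1 o2 o1 ord_max), (t.1 o0 o2 ord_max), (t.1 o1 o0 ord_max), d, h, e.
by split; [split=> //; exact: mkK_surj | split].
Qed.

(** * Values, injectivity and linearity of [phi] *)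

Lemma phi_Der t : inT (is_Derbar delta) t -> is_Der mulJ p0J (phi t).
Proof.
move=> /inT_P [a1 [a2 [a3 [b1 [b2 [b3 [d [h [e [[_ e1 e2 e3] [kd eD]]]]]]]]]]].
have [dd _] := kd.
exists (evJ a1 a2 a3 d h), (odJ b1 b2 b3 e); split; first exact: evJ_sder.
split; first exact: odJ_sder.
by move=> v; apply: phiE => //; rewrite ?(der0 dd) ?(der1 dd).
Qed.

(** The parameters are read off explicit values: [d] on [Z], the vectors [a] and [b] on the [w_j],
    [h] and [e] at [x]. Factors [iZ] cancel because [iZ] squares to -1. *)
Lemma model_inj a1 a2 a3 b1 b2 b3 d h e a1' a2' a3' b1' b2' b3' d' h' e' :
  is_der d -> is_der d' ->
  (forall u, evJ a1 a2 a3 d h u + odJ b1 b2 b3 e u =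
             evJ a1' a2' a3' d' h' u + odJ b1' b2' b3' e' u) ->
  [/\ a1 = a1', a2 = a2' & a3 = a3'] /\ [/\ b1 = b1', b2 = b2' & b3 = b3'] /\
  [/\ d =1 d', h = h' & e = e'].
Proof.
move=> dd dd' H.
have iI f g : iZ * f = iZ * g -> f = g.
  have iK x : x = - (iZ * (iZ * x)) by ring: iZ2.
  by move=> E; rewrite (iK f) E -iK.
have z := (der0 dd, der0 dd', der1 dd, der1 dd', der0 der_delta, der1 der_delta,
  (oppr0, mulr0, mul0r, addr0, subr0, mulr1, add0r, sub0r)).
have Hd f : d f = d' f.
  have := H (mkJ f 0 0 0 0 0 0 0).
  by rewrite !evJ_mk !odJ_mk !mkJ_add !z => /mkJ_inj [[]].
have := H (mkJ 0 1 0 0 0 0 0 0).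
rewrite !evJ_mk !odJ_mk !mkJ_add !z => /mkJ_inj [[_ _ -> E2] [-> _ _ _]].
have := H (mkJ 0 0 1 0 0 0 0 0).
rewrite !evJ_mk !odJ_mk !mkJ_add !z => /mkJ_inj [[_ _ _ /iI ->] [-> _ _ _]].
have := H (mkJ 0 0 0 1 0 0 0 0).
rewrite !evJ_mk !odJ_mk !mkJ_add !z => /mkJ_inj [_ [/oppr_inj/iI -> _ _ _]].
have := H (mkJ 0 0 0 0 1 0 0 0).
rewrite !evJ_mk !odJ_mk !mkJ_add !z => /mkJ_inj [[/oppr_inj/iI -> _ _ _] [-> _ _ _]].
split; last by split; split.
by split=> //; apply/oppr_inj/iI.
Qed.

Lemma phi_inj t t' : inT (is_Derbar delta) t -> inT (is_Derbar delta) t' ->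
  (forall v, phi t v = phi t' v) -> teq t t'.
Proof.
move=> /inT_P [a1 [a2 [a3 [b1 [b2 [b3 [d [h [e [[sX e1 e2 e3] [[dd _] eD]]]]]]]]]]].
move=> /inT_P [a1' [a2' [a3' [b1' [b2' [b3' [d' [h' [e' [[sX' e1' e2' e3'] [[dd' _] eD']]]]]]]]]]].
move=> H.
have [] := @model_inj a1 a2 a3 b1 b2 b3 d h e a1' a2' a3' b1' b2' b3' d' h' e' dd dd'.
  move=> u; rewrite -(phiE u e1 e2 e3 _ _ eD) ?(der0 dd) ?(der1 dd) //.
  by rewrite -(phiE u e1' e2' e3' _ _ eD') ?(der0 dd') ?(der1 dd').
move=> [? ? ?] [[? ? ?] [ed ? ?]]; subst; split; last first.
  by move=> a; rewrite eD eD' /derK !ed.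
elim/ord3_ind; elim/ord3_ind; rewrite ?(skew_diag _ char2 sX) ?(skew_diag _ char2 sX') //;
  rewrite ?e1 ?e1' ?e2 ?e2' ?e3 ?e3' //.
- by rewrite sX sX' e3 e3'.
- by rewrite sX sX' e1 e1'.
- by rewrite sX sX' e2 e2'.
Qed.

Lemma phi_lin k t t' : inT (is_Derbar delta) t -> inT (is_Derbar delta) t' ->
  forall v, phi (tlin k t t') v = k *: phi t v + phi t' v.
Proof.
move=> /inT_P [a1 [a2 [a3 [b1 [b2 [b3 [d [h [e [[sX e1 e2 e3] [[dd _] eD]]]]]]]]]]].
move=> /inT_P [a1' [a2' [a3' [b1' [b2' [b3' [d' [h' [e' [[sX' e1' e2' e3'] [[dd' _] eD']]]]]]]]]]].
move=> u; rewrite (phiE u e1 e2 e3 _ _ eD) ?(der0 dd) ?(der1 dd) //.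
rewrite (phiE u e1' e2' e3' _ _ eD') ?(der0 dd') ?(der1 dd') //.
rewrite (@phiE _ (k%:A * a1 + a1') (k%:A * a2 + a2') (k%:A * a3 + a3')
   (k%:A * b1 + b1') (k%:A * b2 + b2') (k%:A * b3 + b3')
   (fun f => k%:A * d f + d' f) (k%:A * h + h') (k%:A * e + e')) /=.
- have [c [u1 [u2 [u3 [s [t1 [t2 [t3 ->]]]]]]]] := mkJ_surj u.
  rewrite !(evJ_mk, odJ_mk, mkJE).
  by congr mkJ; rewrite ?(derE der_delta); ring.
- by rewrite e1 e1' !mkKE.
- by rewrite e2 e2' !mkKE.
- by rewrite e3 e3' !mkKE.
- by rewrite (der0 dd) (der0 dd') mulr0 addr0.
- by rewrite (der1 dd) (der1 dd') mulr0 addr0.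
- move=> a; rewrite eD eD' (mkK_surj a) !derK_mk !mkKE.
  by congr mkK; ring.
Qed.

(** * Parity components and the bracket *)

Lemma mpart_evJ a1 a2 a3 b1 b2 b3 d h e D u : d 0 = 0 ->
  (forall v, D v = evJ a1 a2 a3 d h v + odJ b1 b2 b3 e v) ->
  mpart p0J false D u = evJ a1 a2 a3 d h u.
Proof.
(* [evJ] preserves the grading and [odJ] reverses it, so the projections separate them; [d 0] arises
   from the coordinates set to 0 by the inner projection. *)
move=> d0 eD; rewrite /mpart sum_bool /part /= !eD.
have [c [u1 [u2 [u3 [s [t1 [t2 [t3 ->]]]]]]]] := mkJ_surj u.
rewrite !(evJ_mk, odJ_mk, mkJE).
by congr mkJ; rewrite ?subrr ?subr0 ?d0 ?(der0 der_delta); ring.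
Qed.

Lemma mpart_odJ a1 a2 a3 b1 b2 b3 d h e D u : d 0 = 0 ->
  (forall v, D v = evJ a1 a2 a3 d h v + odJ b1 b2 b3 e v) ->
  mpart p0J true D u = odJ b1 b2 b3 e u.
Proof.
move=> d0 eD; rewrite /mpart sum_bool /part /= !eD.
have [c [u1 [u2 [u3 [s [t1 [t2 [t3 ->]]]]]]]] := mkJ_surj u.
rewrite !(evJ_mk, odJ_mk, mkJE).
by congr mkJ; rewrite ?subrr ?subr0 ?d0 ?(der0 der_delta); ring.
Qed.

Lemma mpart_derK0 d h e D a : d 0 = 0 -> (forall a, D a = derK d h e a) ->
  mpart p0K false D a = derK d h 0 a.
Proof.
move=> d0 eD; rewrite /mpart sum_bool /part /= !eD (mkK_surj a) !(mkKE, derK_mk).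
by congr mkK; rewrite ?subrr ?subr0 ?d0; ring.
Qed.

Lemma mpart_derK1 d h e D a : d 0 = 0 -> (forall a, D a = derK d h e a) ->
  mpart p0K true D a = derK (fun=> 0) 0 e a.
Proof.
move=> d0 eD; rewrite /mpart sum_bool /part /= !eD (mkK_surj a) !(mkKE, derK_mk).
by congr mkK; rewrite ?subrr ?subr0 ?d0; ring.
Qed.

Lemma phi_part b t : inT (is_Derbar delta) t ->
  forall v, phi (tpart p0K b t) v = mpart p0J b (phi t) v.
Proof.
move=> /inT_P [a1 [a2 [a3 [b1 [b2 [b3 [d [h [e [[sX e1 e2 e3] [[dd _] eD]]]]]]]]]]] v.
have d0 := der0 dd; have d1 := der1 dd.
have phit u := phiE u e1 e2 e3 d0 d1 eD.
case: b.
- rewrite (mpart_odJ _ d0 phit).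
  rewrite (@phiE _ 0 0 0 b1 b2 b3 (fun=> 0) 0 e) //=.
  + have [c [u1 [u2 [u3 [s [t1 [t2 [t3 ->]]]]]]]] := mkJ_surj v.
    rewrite !(evJ_mk, odJ_mk, mkJE).
    by congr mkJ; rewrite ?(der0 der_delta); ring.
  + by rewrite e1 !mkKE subrr subr0.
  + by rewrite e2 !mkKE subrr subr0.
  + by rewrite e3 !mkKE subrr subr0.
  + by move=> a; rewrite (mpart_derK1 _ d0 eD).
- rewrite (mpart_evJ _ d0 phit).
  rewrite (@phiE _ a1 a2 a3 0 0 0 d h 0) //=.
  + have [c [u1 [u2 [u3 [s [t1 [t2 [t3 ->]]]]]]]] := mkJ_surj v.
    rewrite !(evJ_mk, odJ_mk, mkJE).
    by congr mkJ; rewrite ?(der0 der_delta); ring.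
  + by rewrite e1 !mkKE.
  + by rewrite e2 !mkKE.
  + by rewrite e3 !mkKE.
  + by move=> a; rewrite (mpart_derK0 _ d0 eD).
Qed.

(** Here D(f, f') vanishes, D(f, g' x) is eta of [g' * delta f], and D(g x, g' x) is the even
    derivation whose restriction to [Z] is [- 2 g g' delta]. *)
Lemma DopK f g f' g' a :
  Dop mulK p0K (mkK f g) (mkK f' g') a =
  derK (fun c => - (2 * (g * g') * delta c)) (delta (g * g')) (g' * delta f - g * delta f') a.
Proof.
rewrite DopE (mkK_surj a) derK_mk !p0K_mk !mkK_opp !mkK_add !mulK_mk !mkK_opp !mkK_add.
by congr mkK; rewrite ?(derE der_delta); ring.
Qed.

Lemma sbr_derK d h e d' h' e' D D' a :
  is_der d -> is_der d' ->
  (forall a, D a = derK d h e a) -> (forall a, D' a = derK d' h' e' a) ->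
  sbr p0K D D' a =
  derK (fun c => d (d' c) - d' (d c)) (d h' - d' h) (d e' - h * e' - (d' e - h' * e)) a.
Proof.
move=> dd dd' eD eD'.
have E0 := fun a => mpart_derK0 a (der0 dd) eD; have E1 := fun a => mpart_derK1 a (der0 dd) eD.
have E0' := fun a => mpart_derK0 a (der0 dd') eD'.
have E1' := fun a => mpart_derK1 a (der0 dd') eD'.
rewrite sbrE !(E0, E1, E0', E1') (mkK_surj a) !derK_mk !mkK_opp !mkK_add.
by congr mkK; rewrite ?(derE dd, derE dd'); ring.
Qed.

Lemma phi_bracket t t' v : inT (is_Derbar delta) t -> inT (is_Derbar delta) t' ->
  phi (tbr mulK p0K t t') v = sbr p0J (phi t) (phi t') v.
Proof.
move=> /inT_P [a1 [a2 [a3 [b1 [b2 [b3 [d [h [e [[sX e1 e2 e3] [[dd dh] eD]]]]]]]]]]].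
move=> /inT_P [a1' [a2' [a3' [b1' [b2' [b3' [d' [h' [e'
  [[sX' e1' e2' e3'] [[dd' dh'] eD']]]]]]]]]]].
have d0 := der0 dd; have d1 := der1 dd; have d0' := der0 dd'; have d1' := der1 dd'.
have phit u := phiE u e1 e2 e3 d0 d1 eD.
have phit' u := phiE u e1' e2' e3' d0' d1' eD'.
(* The odd-even commutator is written as minus an even-odd one, so that the three commutation lemmas
   cover all four terms. *)
have -> : sbr p0J (phi t) (phi t') v =
   (evJ a1 a2 a3 d h (evJ a1' a2' a3' d' h' v) - evJ a1' a2' a3' d' h' (evJ a1 a2 a3 d h v))
   + (evJ a1 a2 a3 d h (odJ b1' b2' b3' e' v) - odJ b1' b2' b3' e' (evJ a1 a2 a3 d h v))
   - (evJ a1' a2' a3' d' h' (odJ b1 b2 b3 e v) - odJ b1 b2 b3 e (evJ a1' a2' a3' d' h' v))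
   + (odJ b1 b2 b3 e (odJ b1' b2' b3' e' v) + odJ b1' b2' b3' e' (odJ b1 b2 b3 e v)).
  have E0 u := mpart_evJ u d0 phit; have E1 u := mpart_odJ u d0 phit.
  have E0' u := mpart_evJ u d0' phit'; have E1' u := mpart_odJ u d0' phit'.
  by rewrite sbrE !(E0, E1, E0', E1') opprB !addrA.
rewrite evJ_evJ_comm // !evJ_odJ_comm // odJ_odJ_comm //.
have z0 m := skew_diag m char2 sX; have z0' m := skew_diag m char2 sX'.
have e1n : t.1 o1 o2 = mkK (- a1) (- b1) by rewrite sX e1 mkK_opp.
have e2n : t.1 o2 o0 = mkK (- a2) (- b2) by rewrite sX e2 mkK_opp.
have e3n : t.1 o0 o1 = mkK (- a3) (- b3) by rewrite sX e3 mkK_opp.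
have e1n' : t'.1 o1 o2 = mkK (- a1') (- b1') by rewrite sX' e1' mkK_opp.
have e2n' : t'.1 o2 o0 = mkK (- a2') (- b2') by rewrite sX' e2' mkK_opp.
have e3n' : t'.1 o0 o1 = mkK (- a3') (- b3') by rewrite sX' e3' mkK_opp.
have E0' u := mpart_derK0 u d0' eD'; have E1' u := mpart_derK1 u d0' eD'.
have eX := (e1, e2, e3, e1n, e2n, e3n, z0); have eX' := (e1', e2', e3', e1n', e2n', e3n', z0').
(* These parameters are the sums of those produced by the commutation lemmas. The goals after the
   first check that the bracket of [t] and [t'] in the Tits construction has exactly these
   parameters. *)
rewrite (@phiE _
  (a2 * a3' - a3 * a2' + d a1' - d' a1 +
    (delta b2 * b3' - b2 * delta b3' - (delta b3 * b2' - b3 * delta b2') + b1' * e + b1 * e'))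
  (a3 * a1' - a1 * a3' + d a2' - d' a2 +
    (delta b3 * b1' - b3 * delta b1' - (delta b1 * b3' - b1 * delta b3') + b2' * e + b2 * e'))
  (a1 * a2' - a2 * a1' + d a3' - d' a3 +
    (delta b1 * b2' - b1 * delta b2' - (delta b2 * b1' - b2 * delta b1') + b3' * e + b3 * e'))
  (a2 * b3' - a3 * b2' + d b1' + h * b1' - (a2' * b3 - a3' * b2 + d' b1 + h' * b1))
  (a3 * b1' - a1 * b3' + d b2' + h * b2' - (a3' * b1 - a1' * b3 + d' b2 + h' * b2))
  (a1 * b2' - a2 * b1' + d b3' + h * b3' - (a1' * b2 - a2' * b1 + d' b3 + h' * b3))
  (fun f => d (d' f) - d' (d f) + 2 * (b1 * b1' + b2 * b2' + b3 * b3') * delta f)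
  (d h' - d' h - delta (b1 * b1' + b2 * b2' + b3 * b3'))
  (d e' - h * e' - (b1' * delta a1 + b2' * delta a2 + b3' * delta a3)
   - (d' e - h' * e - (b1 * delta a1' + b2 * delta a2' + b3 * delta a3')))).
- have [c [u1 [u2 [u3 [s [t1 [t2 [t3 ->]]]]]]]] := mkJ_surj v.
  rewrite !(evJ_mk, odJ_mk, mkJE).
  by congr mkJ; rewrite ?(derE der_delta); ring.
- rewrite tbr1E sum3 !(E0', E1') !eX !eX' eD mkK_0 !p0K_mk !mkK_opp !mkK_add !derK_mk.
  rewrite !mulK_mk !mkK_opp !mkK_add.
  by congr mkK; rewrite ?(mkK0E, mkK1E, derE der_delta, derE dd, derE dd'); ring.
- rewrite tbr1E sum3 !(E0', E1') !eX !eX' eD mkK_0 !p0K_mk !mkK_opp !mkK_add !derK_mk.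
  rewrite !mulK_mk !mkK_opp !mkK_add.
  by congr mkK; rewrite ?(mkK0E, mkK1E, derE der_delta, derE dd, derE dd'); ring.
- rewrite tbr1E sum3 !(E0', E1') !eX !eX' eD mkK_0 !p0K_mk !mkK_opp !mkK_add !derK_mk.
  rewrite !mulK_mk !mkK_opp !mkK_add.
  by congr mkK; rewrite ?(mkK0E, mkK1E, derE der_delta, derE dd, derE dd'); ring.
- by rewrite !(d0, d0', der0 der_delta); ring.
- by rewrite !(d0, d0', d1, d1', der1 der_delta); ring.
- move=> a; rewrite tbr2E (sbr_derK _ dd dd' eD eD') !eX !eX' mkK_0 !DopK (mkK_surj a) !derK_mk.
  (* trace (ad a ad b) = - 2 <a, b>, which cancels the factor 1/2 *)
  set S := (X in _ *: X).
  pose W := derK (fun f => 2 * (b1 * b1' + b2 * b2' + b3 * b3') * delta f)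
    (- delta (b1 * b1' + b2 * b2' + b3 * b3'))
    (b1 * delta a1' + b2 * delta a2' + b3 * delta a3'
     - (b1' * delta a1 + b2' * delta a2 + b3' * delta a3)) (mkK (a ord0) (a ord_max)).
  have -> : S = W + W.
    rewrite /S /W !derK_mk !mkK_add.
    by congr mkK; rewrite ?(derE der_delta); ring.
  rewrite -mulr2n -scaler_nat scalerA mulVf // scale1r /W derK_mk mkK_add.
  by congr mkK; ring.
Qed.

(** * Every derivation of J is in the image *)

Hypothesis delta_span : forall z : Z, exists s : seq (Z * Z), z = \sum_(p <- s) p.1 * delta p.2.

(** Multiply by 1, written as a sum of products [g * delta f]. *)
Lemma delta_cancel x y : (forall f, delta f * x = delta f * y) -> x = y.
Proof.
move=> H; have [s e1] := delta_span 1.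
rewrite -[x]mul1r -[y]mul1r e1 !mulr_suml; apply: eq_bigr => p _.
by rewrite -!mulrA H.
Qed.

Lemma double_eq0 (x : Z) : x + x = 0 -> x = 0.
Proof.
rewrite -mulr2n -scaler_nat => /eqP; rewrite scaler_eq0 (negPf char2).
by move/eqP.
Qed.

Ltac prodJ := rewrite mulJ_mk ?(derE der_delta); congr mkJ; ring.

Let zE := (der0 der_delta, der1 der_delta,
  (oppr0, mulr0, mul0r, addr0, subr0, add0r, sub0r, mulr1, mul1r)).

Notation cJ f := (mkJ f 0 0 0 0 0 0 0).
Notation w1 f := (mkJ 0 f 0 0 0 0 0 0).
Notation w2 f := (mkJ 0 0 f 0 0 0 0 0).
Notation w3 f := (mkJ 0 0 0 f 0 0 0 0).
Notation x0 f := (mkJ 0 0 0 0 f 0 0 0).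
Notation x1 f := (mkJ 0 0 0 0 0 f 0 0).
Notation x2 f := (mkJ 0 0 0 0 0 0 f 0).
Notation x3 f := (mkJ 0 0 0 0 0 0 0 f).

Lemma homJ_even (c u1 u2 u3 : Z) : Defs.hom p0J false (mkJ c u1 u2 u3 0 0 0 0).
Proof. by apply/homJ0P; exists c, u1, u2, u3. Qed.

Lemma homJ_odd (s t1 t2 t3 : Z) : Defs.hom p0J true (mkJ 0 0 0 0 s t1 t2 t3).
Proof. by apply/homJ1P; exists s, t1, t2, t3. Qed.

Lemma mkJ_decomp (c u1 u2 u3 s t1 t2 t3 : Z) :
  mkJ c u1 u2 u3 s t1 t2 t3 =
  cJ c + w1 u1 + w2 u2 + w3 u3 + x0 s + x1 t1 + x2 t2 + x3 t3.
Proof. by rewrite !mkJ_add !(addr0, add0r). Qed.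

(** The relations between the basis vectors successively restrict the coordinates of their images;
    what survives is the parameters of an [evJ]. *)
Lemma sder0J_P D : is_sder mulJ p0J false D ->
  exists a1 a2 a3 d h, kder d h /\ forall u, D u = evJ a1 a2 a3 d h u.
Proof.
move=> [lD [hD mD]].
have DD u v := is_lin_add u v lD.
have D0 : D 0 = 0 by apply: (addrI (D 0)); rewrite -DD !addr0.
have DN u : D (- u) = - D u by apply: (addrI (D u)); rewrite -DD !subrr D0.
have P p q u v w : Defs.hom p0J p u -> Defs.hom p0J q v -> mulJ u v = w ->
    D w = mulJ (D u) v + mulJ u (D v).
  by move=> hu hv <-; rewrite (mD p q) //= scale1r.
have ev c u1 u2 u3 : exists c' u1' u2' u3',
    D (mkJ c u1 u2 u3 0 0 0 0) = mkJ c' u1' u2' u3' 0 0 0 0.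
  by apply/homJ0P/(hD false)/homJ_even.
have od s t1 t2 t3 : exists s' t1' t2' t3',
    D (mkJ 0 0 0 0 s t1 t2 t3) = mkJ 0 0 0 0 s' t1' t2' t3'.
  by apply/homJ1P/(hD true)/homJ_odd.
have [p0 [p1 [p2 [p3 W1]]]] := ev 0 1 0 0.
have [q0 [q1 [q2 [q3 W2]]]] := ev 0 0 1 0.
have [r0 [r1 [r2 [r3 W3]]]] := ev 0 0 0 1.
have [h [t1 [t2 [t3 X0]]]] := od 1 0 0 0.
have [s1 [l11 [l12 [l13 Y1]]]] := od 0 1 0 0.
have [s2 [l21 [l22 [l23 Y2]]]] := od 0 0 1 0.
have [s3 [l31 [l32 [l33 Y3]]]] := od 0 0 0 1.
have he := homJ_even; have ho := homJ_odd.
have D1 : D (cJ 1) = 0.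
  have := P false false (cJ 1) (cJ 1) (cJ 1) (he _ _ _ _) (he _ _ _ _).
  have [c [u1 [u2 [u3 E]]]] := ev 1 0 0 0.
  rewrite E !mulJ_mk !mkJ_add !zE => /(_ erefl) /mkJ_inj [[e0 e1 e2 e3] _].
  have z (y : Z) : y = y + y -> y = 0 by move=> /(congr1 (fun v => v - y)); rewrite addrK subrr.
  by rewrite (z _ e0) (z _ e1) (z _ e2) (z _ e3) mkJ_0.
(* The squares of the [w_j] are 1 or -1: this removes from [D w_j] its components on 1 and on
   [w_j]. *)
have [ep1 ep0] : p1 = 0 /\ p0 = 0.
  have := P false false (w1 1) (w1 1) (cJ 1) (he _ _ _ _) (he _ _ _ _).
  rewrite W1 D1 mkJ_0 !mulJ_mk !mkJ_add !zE => /(_ erefl) /mkJ_inj [[e0 e1 _ _] _].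
  by split; apply: double_eq0.
have [eq2 eq0] : q2 = 0 /\ q0 = 0.
  have := P false false (w2 1) (w2 1) (cJ 1) (he _ _ _ _) (he _ _ _ _).
  rewrite W2 D1 mkJ_0 !mulJ_mk !mkJ_add !zE => /(_ erefl) /mkJ_inj [[e0 _ e1 _] _].
  by split; apply: double_eq0.
have [er3 er0] : r3 = 0 /\ r0 = 0.
  have := P false false (w3 1) (w3 1) (- cJ 1) (he _ _ _ _) (he _ _ _ _).
  rewrite W3 DN D1 mkJ_0 !mulJ_mk !mkJ_opp !mkJ_add !zE => /(_ erefl) /mkJ_inj [[e0 _ _ e1] _].
  split; last exact: double_eq0.
  by apply: double_eq0; apply: oppr_inj; rewrite oppr0 opprD.
subst p1 p0 q2 q0 r3 r0.
(* Orthogonality of the [w_j] makes the remaining matrix skew for the form with diagonal 1, 1,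
   -1. *)
have e12 : q1 = - p2.
  have := P false false (w1 1) (w2 1) 0 (he _ _ _ _) (he _ _ _ _).
  rewrite W1 W2 D0 mkJ_0 !mulJ_mk !mkJ_add !zE => /(_ erefl) /mkJ_inj [[e0 _ _ _] _].
  by apply/eqP; rewrite -addr_eq0 addrC -e0.
have e13 : r1 = p3.
  have := P false false (w1 1) (w3 1) 0 (he _ _ _ _) (he _ _ _ _).
  rewrite W1 W3 D0 mkJ_0 !mulJ_mk !mkJ_add !zE => /(_ erefl) /mkJ_inj [[e0 _ _ _] _].
  by apply/eqP; rewrite -subr_eq0 addrC -e0.
have e23 : r2 = q3.
  have := P false false (w2 1) (w3 1) 0 (he _ _ _ _) (he _ _ _ _).
  rewrite W2 W3 D0 mkJ_0 !mulJ_mk !mkJ_add !zE => /(_ erefl) /mkJ_inj [[e0 _ _ _] _].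
  by apply/eqP; rewrite -subr_eq0 addrC -e0.
subst q1 r1 r2.
pose d f := D (cJ f) (@Ordinal 8 0 isT).
have DZ f : D (cJ f) = cJ (d f).
  have [c [u1 [u2 [u3 E]]]] := ev f 0 0 0.
  (* Differentiating [f = (f w1) w1] removes the components of [D f] on [w2] and [w3];
     [f = (f w2) w2] removes the one on [w1]. *)
  have F1 : D (w1 f) = mulJ (D (cJ f)) (w1 1) + mulJ (cJ f) (D (w1 1)).
    by apply: (P false false) => //; prodJ.
  have F2 : D (w2 f) = mulJ (D (cJ f)) (w2 1) + mulJ (cJ f) (D (w2 1)).
    by apply: (P false false) => //; prodJ.
  have G1 : D (cJ f) = mulJ (D (w1 f)) (w1 1) + mulJ (w1 f) (D (w1 1)).
    by apply: (P false false) => //; prodJ.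
  have G2 : D (cJ f) = mulJ (D (w2 f)) (w2 1) + mulJ (w2 f) (D (w2 1)).
    by apply: (P false false) => //; prodJ.
  move: G1 G2; rewrite F1 F2 E W1 W2 /d E !mulJ_mk !mkJ_add !mulJ_mk !mkJ_add !zE.
  by move=> /mkJ_inj [[_ _ -> ->] _] /mkJ_inj [[_ -> _ _] _]; rewrite ffunE.
have Dw1 f : D (w1 f) = mkJ 0 (d f) (f * p2) (f * p3) 0 0 0 0.
  rewrite (P false false (cJ f) (w1 1)) //; last by prodJ.
  by rewrite DZ W1; rewrite !mulJ_mk mkJ_add !zE.
have Dw2 f : D (w2 f) = mkJ 0 (- (f * p2)) (d f) (f * q3) 0 0 0 0.
  rewrite (P false false (cJ f) (w2 1)) //; last by prodJ.
  by rewrite DZ W2; rewrite !mulJ_mk mkJ_add !zE mulrN.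
have Dw3 f : D (w3 f) = mkJ 0 (f * p3) (f * q3) (d f) 0 0 0 0.
  rewrite (P false false (cJ f) (w3 1)) //; last by prodJ.
  by rewrite DZ W3; rewrite !mulJ_mk mkJ_add !zE.
have dd : is_der d.
  split=> [k f g|f g].
    have := lD k (cJ f) (cJ g).
    rewrite mkJ_scale mkJ_add !mulr0 !addr0 !DZ mkJ_scale mkJ_add => /mkJ_inj [[]].
    by rewrite !mulr_algl.
  have := P false false (cJ f) (cJ g) (cJ (f * g)) (he _ _ _ _) (he _ _ _ _).
  rewrite !DZ !mulJ_mk !mkJ_add !zE => /(_ erefl) /mkJ_inj [[-> _ _ _] _].
  by [].
(* [w_j x = 0], because [delta 1 = 0]; this fixes the components of [D x] on the [x_k]. *)
have [et3 et2] : t3 = delta p2 /\ t2 = delta p3.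
  have := P false true (w1 1) (x0 1) 0 (he _ _ _ _) (ho _ _ _ _).
  rewrite W1 X0 D0 mkJ_0 !mulJ_mk !mkJ_add !zE => /(_ erefl) /mkJ_inj [_ [_ _ e1 e2]].
  by split; apply/eqP; rewrite eq_sym -subr_eq0 -?e1 -?e2.
have et1 : t1 = - delta q3.
  have := P false true (w2 1) (x0 1) 0 (he _ _ _ _) (ho _ _ _ _).
  rewrite W2 X0 D0 mkJ_0 !mulJ_mk !mkJ_add !zE => /(_ erefl) /mkJ_inj [_ [_ _ _ e2]].
  by apply/eqP; rewrite -addr_eq0 addrC -e2.
subst t1 t2 t3.
(* [x x_j = - w_j] fixes [D x_j] except for its component on [x]. *)
have [el11 [el12 el13]] : l11 = - h /\ l12 = p2 /\ l13 = p3.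
  have := P true true (x0 1) (x1 1) (- w1 1) (ho _ _ _ _) (ho _ _ _ _).
  rewrite DN W1 X0 Y1 !mulJ_mk !mkJ_opp !mkJ_add !zE => /(_ erefl) /mkJ_inj [[_ e1 e2 e3] _].
  by split; [apply/eqP; rewrite eq_sym -subr_eq0 -e1 | split; apply/oppr_inj].
have [el21 [el22 el23]] : l21 = - p2 /\ l22 = - h /\ l23 = q3.
  have := P true true (x0 1) (x2 1) (- w2 1) (ho _ _ _ _) (ho _ _ _ _).
  rewrite DN W2 X0 Y2 !mulJ_mk !mkJ_opp !mkJ_add !zE => /(_ erefl) /mkJ_inj [[_ e1 e2 e3] _].
  by split; [apply/oppr_inj | split; [apply/eqP; rewrite eq_sym -subr_eq0 -e2 | apply/oppr_inj]].
have [el31 [el32 el33]] : l31 = p3 /\ l32 = q3 /\ l33 = - h.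
  have := P true true (x0 1) (x3 1) (- w3 1) (ho _ _ _ _) (ho _ _ _ _).
  rewrite DN W3 X0 Y3 !mulJ_mk !mkJ_opp !mkJ_add !zE => /(_ erefl) /mkJ_inj [[_ e1 e2 e3] _].
  by split; [apply/oppr_inj | split; [apply/oppr_inj | apply/eqP; rewrite eq_sym -subr_eq0 -e3]].
subst l11 l12 l13 l21 l22 l23 l31 l32 l33.
have Dx0 f : D (x0 f) = mkJ 0 0 0 0 (d f + h * f) (- delta q3 * f) (delta p3 * f) (delta p2 * f).
  rewrite (P false true (cJ f) (x0 1)) //; last by prodJ.
  by rewrite DZ X0; rewrite !mulJ_mk mkJ_add; congr mkJ; rewrite ?zE; ring.
have Dx1 f : D (x1 f) = mkJ 0 0 0 0 (f * s1) (d f - h * f) (p2 * f) (p3 * f).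
  rewrite (P false true (cJ f) (x1 1)) //; last by prodJ.
  by rewrite DZ Y1; rewrite !mulJ_mk mkJ_add; congr mkJ; rewrite ?zE; ring.
have Dx2 f : D (x2 f) = mkJ 0 0 0 0 (f * s2) (- p2 * f) (d f - h * f) (q3 * f).
  rewrite (P false true (cJ f) (x2 1)) //; last by prodJ.
  by rewrite DZ Y2; rewrite !mulJ_mk mkJ_add; congr mkJ; rewrite ?zE; ring.
have Dx3 f : D (x3 f) = mkJ 0 0 0 0 (f * s3) (p3 * f) (q3 * f) (d f - h * f).
  rewrite (P false true (cJ f) (x3 1)) //; last by prodJ.
  by rewrite DZ Y3; rewrite !mulJ_mk mkJ_add; congr mkJ; rewrite ?zE; ring.
(* Differentiating [(f w_j) x = delta f x_j] makes the component on [x] vanish after multiplication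
   by any [delta f]; its [x_1] coordinate gives the commutation rule of [kder]. *)
have K1 f : delta f * s1 = 0 /\ d (delta f) = delta (d f) + 2 * h * delta f.
  have : D (x1 (delta f)) = mulJ (D (w1 f)) (x0 1) + mulJ (w1 f) (D (x0 1)).
    by apply: (P false true) => //; prodJ.
  rewrite Dx1 Dw1 X0 !mulJ_mk mkJ_add !zE => /mkJ_inj [_ [-> e1 _ _]]; split=> //.
  have -> : d (delta f) = (d (delta f) - h * delta f) + h * delta f by ring.
  by rewrite e1; ring.
have K2 f : delta f * s2 = 0.
  have : D (x2 (delta f)) = mulJ (D (w2 f)) (x0 1) + mulJ (w2 f) (D (x0 1)).
    by apply: (P false true) => //; prodJ.
  by rewrite Dx2 Dw2 X0 !mulJ_mk mkJ_add !zE => /mkJ_inj [_ [-> _ _ _]].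
have K3 f : delta f * s3 = 0.
  have : D (x3 (delta f)) = mulJ (D (w3 f)) (x0 1) + mulJ (w3 f) (D (x0 1)).
    by apply: (P false true) => //; prodJ.
  by rewrite Dx3 Dw3 X0 !mulJ_mk mkJ_add !zE => /mkJ_inj [_ [-> _ _ _]].
have es1 : s1 = 0 by apply: delta_cancel => f; rewrite (K1 f).1 mulr0.
have es2 : s2 = 0 by apply: delta_cancel => f; rewrite K2 mulr0.
have es3 : s3 = 0 by apply: delta_cancel => f; rewrite K3 mulr0.
subst s1 s2 s3.
(* In [evJ] the coefficients are [p2 = a3], [p3 = - iZ * a2] and [q3 = iZ * a1]; these are solved
   for the [a_j]. *)
exists (- iZ * q3), (iZ * p3), p2, d, h; split; first by split=> // f; case: (K1 f).
move=> u; have [c [u1 [u2 [u3 [s [y1 [y2 [y3 ->]]]]]]]] := mkJ_surj u.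
rewrite mkJ_decomp !DD DZ Dw1 Dw2 Dw3 Dx0 Dx1 Dx2 Dx3 -mkJ_decomp evJ_mk !mkJ_add.
by congr mkJ; rewrite ?(derE der_delta, der_iZ der_delta); ring: iZ2.
Qed.

Lemma sder1J_P D : is_sder mulJ p0J true D ->
  exists b1 b2 b3 e, forall u, D u = odJ b1 b2 b3 e u.
Proof.
move=> [lD [hD mD]].
have DD u v := is_lin_add u v lD.
have D0 : D 0 = 0 by apply: (addrI (D 0)); rewrite -DD !addr0.
have DN u : D (- u) = - D u by apply: (addrI (D u)); rewrite -DD !subrr D0.
have P q u v w : Defs.hom p0J false u -> Defs.hom p0J q v -> mulJ u v = w ->
    D w = mulJ (D u) v + mulJ u (D v).
  by move=> hu hv <-; rewrite (mD false q) //= scale1r.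
have ev c u1 u2 u3 : exists s' t1' t2' t3',
    D (mkJ c u1 u2 u3 0 0 0 0) = mkJ 0 0 0 0 s' t1' t2' t3'.
  by apply/homJ1P/(hD false)/homJ_even.
have od s t1 t2 t3 : exists c' u1' u2' u3',
    D (mkJ 0 0 0 0 s t1 t2 t3) = mkJ c' u1' u2' u3' 0 0 0 0.
  by apply/homJ0P/(hD true)/homJ_odd.
have [p0 [p1 [p2 [p3 W1]]]] := ev 0 1 0 0.
have [q0 [q1 [q2 [q3 W2]]]] := ev 0 0 1 0.
have [r0 [r1 [r2 [r3 W3]]]] := ev 0 0 0 1.
have [m [n1 [n2 [n3 X0]]]] := od 1 0 0 0.
have [l10 [l11 [l12 [l13 Y1]]]] := od 0 1 0 0.
have [l20 [l21 [l22 [l23 Y2]]]] := od 0 0 1 0.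
have [l30 [l31 [l32 [l33 Y3]]]] := od 0 0 0 1.
have he := homJ_even; have ho := homJ_odd.
have D1 : D (cJ 1) = 0.
  have := P false (cJ 1) (cJ 1) (cJ 1) (he _ _ _ _) (he _ _ _ _).
  have [c [u1 [u2 [u3 E]]]] := ev 1 0 0 0.
  rewrite E !mulJ_mk !mkJ_add !zE => /(_ erefl) /mkJ_inj [_ [e0 e1 e2 e3]].
  have z (y : Z) : y = y + y -> y = 0 by move=> /(congr1 (fun v => v - y)); rewrite addrK subrr.
  by rewrite (z _ e0) (z _ e1) (z _ e2) (z _ e3) mkJ_0.
have dblN (y : Z) : 0 = - y - y -> y = 0.
  by move=> e0; apply: double_eq0; apply: oppr_inj; rewrite oppr0 opprD.
have dblP (y : Z) : 0 = y + y -> y = 0 by move=> e0; apply: double_eq0.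
(* As [w_j x_k] is plus or minus the third [x_l], the squares of the [w_j] leave in [D w_j] only
   components on [x] and [x_j]. *)
have [ep2 ep3] : p2 = 0 /\ p3 = 0.
  have := P false (w1 1) (w1 1) (cJ 1) (he _ _ _ _) (he _ _ _ _).
  rewrite W1 D1 mkJ_0 !mulJ_mk !mkJ_add !zE => /(_ erefl) /mkJ_inj [_ [_ _ e1 e2]].
  by split; apply: dblN.
have [eq1 eq3] : q1 = 0 /\ q3 = 0.
  have := P false (w2 1) (w2 1) (cJ 1) (he _ _ _ _) (he _ _ _ _).
  rewrite W2 D1 mkJ_0 !mulJ_mk !mkJ_add !zE => /(_ erefl) /mkJ_inj [_ [_ e1 _ e2]].
  by split; apply: dblP.
have [er1 er2] : r1 = 0 /\ r2 = 0.
  have := P false (w3 1) (w3 1) (- cJ 1) (he _ _ _ _) (he _ _ _ _).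
  rewrite W3 DN D1 mkJ_0 !mulJ_mk !mkJ_opp !mkJ_add !zE => /(_ erefl) /mkJ_inj [_ [_ e1 e2 _]].
  by split; [apply: dblP | apply: dblN].
subst p2 p3 q1 q3 r1 r2.
(* Orthogonality of the [w_j] forces one common coefficient of [D w_j] on [x_j], which will be
   [iZ * e]. *)
have e12 : q2 = p1.
  have := P false (w1 1) (w2 1) 0 (he _ _ _ _) (he _ _ _ _).
  rewrite W1 W2 D0 mkJ_0 !mulJ_mk !mkJ_add !zE => /(_ erefl) /mkJ_inj [_ [_ _ _ e0]].
  by apply/eqP; rewrite eq_sym -subr_eq0 -e0.
have e13 : r3 = p1.
  have := P false (w1 1) (w3 1) 0 (he _ _ _ _) (he _ _ _ _).
  rewrite W1 W3 D0 mkJ_0 !mulJ_mk !mkJ_add !zE => /(_ erefl) /mkJ_inj [_ [_ _ e0 _]].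
  by apply/eqP; rewrite eq_sym -subr_eq0 -e0.
subst q2 r3.
have DZ f : D (cJ f) = mkJ 0 0 0 0 0 (delta f * p0) (delta f * q0) (- (delta f * r0)).
  have [A [B1 [B2 [B3 E]]]] := ev f 0 0 0.
  (* Differentiating [(f w_j) w_j], which is [f] or [- f], fixes the component of [D f] on [x_j];
     the case [j = 1] also removes the one on [x]. *)
  have step w n (hw : Defs.hom p0J false w) (hfw : Defs.hom p0J false (mulJ (cJ f) w)) :
      mulJ (mulJ (cJ f) w) w = n ->
      D n = mulJ (mulJ (D (cJ f)) w + mulJ (cJ f) (D w)) w + mulJ (mulJ (cJ f) w) (D w).
    by move=> en; rewrite (P false (mulJ (cJ f) w) w) // (P false (cJ f) w).
  have G1 := step (w1 1) (cJ f) (he _ _ _ _).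
  have G2 := step (w2 1) (cJ f) (he _ _ _ _).
  have G3 := step (w3 1) (- cJ f) (he _ _ _ _).
  move: G1; rewrite E W1 !mulJ_mk !mkJ_add !zE !mulJ_mk !mkJ_add !zE.
  move=> /(_ (he _ _ _ _) erefl) /mkJ_inj [_ [eA eB1 _ _]].
  move: G2; rewrite E W2 !mulJ_mk !mkJ_add !zE !mulJ_mk !mkJ_add !zE.
  move=> /(_ (he _ _ _ _) erefl) /mkJ_inj [_ [_ _ eB2 _]].
  move: G3; rewrite DN E W3 !mulJ_mk !mkJ_opp !mkJ_add !zE !mulJ_mk !mkJ_add !zE.
  move=> /(_ (he _ _ _ _) erefl) /mkJ_inj [_ [_ _ _ eB3]].
  by rewrite eA eB1 eB2 -[B3]opprK eB3.
have Dw1 f : D (w1 f) = mkJ 0 0 0 0 (f * p0) (f * p1) (delta f * r0) (- (delta f * q0)).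
  rewrite (P false (cJ f) (w1 1)) //; last by prodJ.
  by rewrite DZ W1; rewrite !mulJ_mk mkJ_add !zE opprK.
have Dw2 f : D (w2 f) = mkJ 0 0 0 0 (f * q0) (- (delta f * r0)) (f * p1) (delta f * p0).
  rewrite (P false (cJ f) (w2 1)) //; last by prodJ.
  by rewrite DZ W2; rewrite !mulJ_mk mkJ_add !zE.
have Dw3 f : D (w3 f) = mkJ 0 0 0 0 (f * r0) (- (delta f * q0)) (delta f * p0) (f * p1).
  rewrite (P false (cJ f) (w3 1)) //; last by prodJ.
  by rewrite DZ W3; rewrite !mulJ_mk mkJ_add !zE.
have [em en1] : m = - p1 /\ n1 = - delta p0.
  have := P true (w1 1) (x0 1) 0 (he _ _ _ _) (ho _ _ _ _).
  rewrite W1 X0 D0 mkJ_0 !mulJ_mk !mkJ_add !zE => /(_ erefl) /mkJ_inj [[e1 e2 _ _] _].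
  by split; apply/eqP; rewrite -addr_eq0 addrC -?e1 -?e2.
have en2 : n2 = - delta q0.
  have := P true (w2 1) (x0 1) 0 (he _ _ _ _) (ho _ _ _ _).
  rewrite W2 X0 D0 mkJ_0 !mulJ_mk !mkJ_add !zE => /(_ erefl) /mkJ_inj [[e1 _ _ _] _].
  by apply/eqP; rewrite -addr_eq0 addrC -?e1.
have en3 : n3 = delta r0.
  have := P true (w3 1) (x0 1) 0 (he _ _ _ _) (ho _ _ _ _).
  rewrite W3 X0 D0 mkJ_0 !mulJ_mk !mkJ_add !zE => /(_ erefl) /mkJ_inj [[e1 _ _ _] _].
  by apply/eqP; rewrite -subr_eq0 -oppr_eq0 opprB e1.
subst m n1 n2 n3.
have Dx0 f : D (x0 f) = mkJ (- p1 * f) (p0 * delta f - delta p0 * f)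
    (q0 * delta f - delta q0 * f) (delta r0 * f - r0 * delta f) 0 0 0 0.
  rewrite (P true (cJ f) (x0 1)) //; last by prodJ.
  by rewrite DZ X0; rewrite !mulJ_mk mkJ_add; congr mkJ; rewrite ?zE; ring.
have Dx1 f : D (x1 f) = mkJ (f * l10) (f * l11) (f * l12) (f * l13) 0 0 0 0.
  rewrite (P true (cJ f) (x1 1)) //; last by prodJ.
  by rewrite DZ Y1; rewrite !mulJ_mk mkJ_add; congr mkJ; rewrite ?zE; ring.
have Dx2 f : D (x2 f) = mkJ (f * l20) (f * l21) (f * l22) (f * l23) 0 0 0 0.
  rewrite (P true (cJ f) (x2 1)) //; last by prodJ.
  by rewrite DZ Y2; rewrite !mulJ_mk mkJ_add; congr mkJ; rewrite ?zE; ring.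
have Dx3 f : D (x3 f) = mkJ (f * l30) (f * l31) (f * l32) (f * l33) 0 0 0 0.
  rewrite (P true (cJ f) (x3 1)) //; last by prodJ.
  by rewrite DZ Y3; rewrite !mulJ_mk mkJ_add; congr mkJ; rewrite ?zE; ring.
(* Here [(f w_j) x = delta f x_j] determines all of [D x_j], up to the factor [delta f], which
   [delta_cancel] removes below. *)
have K1 f : [/\ delta f * l10 = delta f * p0, delta f * l11 = delta f * 0,
    delta f * l12 = delta f * r0 & delta f * l13 = delta f * - q0].
  have : D (x1 (delta f)) = mulJ (D (w1 f)) (x0 1) + mulJ (w1 f) (D (x0 1)).
    by apply: (P true) => //; prodJ.
  rewrite Dx1 Dw1 X0 !mulJ_mk mkJ_add => /mkJ_inj [[-> -> -> ->] _].
  by split; rewrite ?(derE der_delta); ring.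
have K2 f : [/\ delta f * l20 = delta f * q0, delta f * l21 = delta f * - r0,
    delta f * l22 = delta f * 0 & delta f * l23 = delta f * p0].
  have : D (x2 (delta f)) = mulJ (D (w2 f)) (x0 1) + mulJ (w2 f) (D (x0 1)).
    by apply: (P true) => //; prodJ.
  rewrite Dx2 Dw2 X0 !mulJ_mk mkJ_add => /mkJ_inj [[-> -> -> ->] _].
  by split; rewrite ?(derE der_delta); ring.
have K3 f : [/\ delta f * l30 = delta f * r0, delta f * l31 = delta f * - q0,
    delta f * l32 = delta f * p0 & delta f * l33 = delta f * 0].
  have : D (x3 (delta f)) = mulJ (D (w3 f)) (x0 1) + mulJ (w3 f) (D (x0 1)).
    by apply: (P true) => //; prodJ.
  rewrite Dx3 Dw3 X0 !mulJ_mk mkJ_add => /mkJ_inj [[-> -> -> ->] _].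
  by split; rewrite ?(derE der_delta); ring.
have [El10 El11 El12 El13] : [/\ l10 = p0, l11 = 0, l12 = r0 & l13 = - q0].
  by split; apply: delta_cancel => f; case: (K1 f).
have [El20 El21 El22 El23] : [/\ l20 = q0, l21 = - r0, l22 = 0 & l23 = p0].
  by split; apply: delta_cancel => f; case: (K2 f).
have [El30 El31 El32 El33] : [/\ l30 = r0, l31 = - q0, l32 = p0 & l33 = 0].
  by split; apply: delta_cancel => f; case: (K3 f).
subst l10 l11 l12 l13 l20 l21 l22 l23 l30 l31 l32 l33.
(* Solved from [r0 = - iZ * b3] and [p1 = iZ * e] in [odJ]. *)
exists p0, q0, (iZ * r0), (- iZ * p1).
move=> u; have [c [u1 [u2 [u3 [s [y1 [y2 [y3 ->]]]]]]]] := mkJ_surj u.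
rewrite mkJ_decomp !DD DZ Dw1 Dw2 Dw3 Dx0 Dx1 Dx2 Dx3 -mkJ_decomp odJ_mk !mkJ_add.
by congr mkJ; rewrite ?(derE der_delta, der_iZ der_delta); ring: iZ2.
Qed.

(** The matrix of the vector product with [(A1, A2, A3)], inverse to the reading of entries in
    [phi]. *)
Definition skewK (A1 A2 A3 : KCK Z) (j k : 'I_3) : KCK Z :=
  match val j, val k with
  | 2%N, 1%N => A1 | 1%N, 2%N => - A1
  | 0%N, 2%N => A2 | 2%N, 0%N => - A2
  | 1%N, 0%N => A3 | 0%N, 1%N => - A3
  | _, _ => 0
  end.

Lemma skewKP A1 A2 A3 : Defs.skew (skewK A1 A2 A3).
Proof. by elim/ord3_ind; elim/ord3_ind; rewrite /skewK /= ?opprK ?oppr0. Qed.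

Lemma phi_skewK a1 a2 a3 b1 b2 b3 d h e u : is_der d ->
  phi (skewK (mkK a1 b1) (mkK a2 b2) (mkK a3 b3), derK d h e) u =
  evJ a1 a2 a3 d h u + odJ b1 b2 b3 e u.
Proof. by move=> dd; apply: phiE; rewrite ?(der0 dd) ?(der1 dd). Qed.

Lemma phi_surj D : is_Der mulJ p0J D ->
  exists t, inT (is_Derbar delta) t /\ forall v, phi t v = D v.
Proof.
move=> [D0 [D1 [/sder0J_P [a1 [a2 [a3 [d [h [kd E0]]]]]] [/sder1J_P [b1 [b2 [b3 [e E1]]]] E]]]].
exists (skewK (mkK a1 b1) (mkK a2 b2) (mkK a3 b3), derK d h e); split.
  by split; [exact: skewKP | apply/Derbar_P => //; exists d, h, e].
by move=> v; rewrite E E0 E1 phi_skewK //; case: kd.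
Qed.

(** * Inner derivations *)

(** Pairs of [w_j] yield the image of so_3 (x) Z, pairs of [x] and [w_j] that of so_3 (x) Zx; D(f x,
    g x) and D(f, g x) correspond to the inner derivations of [K], the latter up to the factor
    [iZ]. *)
Lemma DopJ c u1 u2 u3 s t1 t2 t3 c' u1' u2' u3' s' t1' t2' t3' v :
  Dop mulJ p0J (mkJ c u1 u2 u3 s t1 t2 t3) (mkJ c' u1' u2' u3' s' t1' t2' t3') v =
  evJ (iZ * (u2 * u3' - u2' * u3 + s * t1' + s' * t1))
      (iZ * (u1' * u3 - u1 * u3' + s * t2' + s' * t2))
      (u1' * u2 - u1 * u2' + s * t3' + s' * t3)
      (fun f => - (2 * (s * s') * delta f)) (delta (s * s')) v
  + odJ (s * u1' - s' * u1) (s * u2' - s' * u2) (- iZ * (s * u3' - s' * u3))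
      (iZ * (s' * delta c - s * delta c' + u1 * t1' + u2 * t2' - u3 * t3'
             - (u1' * t1 + u2' * t2 - u3' * t3))) v.
Proof.
have [v0 [v1 [v2 [v3 [y0 [y1 [y2 [y3 ->]]]]]]]] := mkJ_surj v.
rewrite DopE evJ_mk odJ_mk !p0J_mk !mkJ_opp !mkJ_add !subrr !subr0.
rewrite !mulJ_mk !mkJ_opp !mkJ_add.
by congr mkJ; rewrite ?(derE der_delta, der_iZ der_delta); ring: iZ2.
Qed.

Lemma Inder_K_P D : is_Inder mulK p0K D ->
  exists d h e, [/\ kder d h, forall a, D a = derK d h e a &
    is_Inder mulJ p0J (fun u => evJ 0 0 0 d h u + odJ 0 0 0 e u)].
Proof.
move: D; apply: Inder_ind => [f g fg [d [h [e [kd E I]]]] | | k A B D0 _ [d [h [e [kd E I]]]]].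
- by exists d, h, e; split=> // a; rewrite -fg.
- exists (fun=> 0), 0, 0; split.
  + split; last by move=> f; rewrite (der0 der_delta) mulr0 mul0r addr0.
    by split=> [k f g|f g]; rewrite ?scaler0 ?mulr0 ?mul0r addr0.
  + by move=> a; rewrite /derK !mul0r !addr0 -mkK_0.
  + exists [::] => u; rewrite big_nil.
    have [c [u1 [u2 [u3 [s [t1 [t2 [t3 ->]]]]]]]] := mkJ_surj u.
    rewrite !(evJ_mk, odJ_mk, mkJE) mkJ_0.
    by congr mkJ; rewrite ?(der0 der_delta); ring.
have [dd dh] := kd.
rewrite (mkK_surj A) (mkK_surj B).
move: (A ord0) (A ord_max) (B ord0) (B ord_max) => c s c' s'.
exists (fun f => k%:A * - (2 * (s * s') * delta f) + d f), (k%:A * delta (s * s') + h),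
  (k%:A * (s' * delta c - s * delta c') + e); split.
- split; first split.
  + move=> l f g; rewrite -[l *: f]mulr_algl -[X in _ = X + _]mulr_algl.
    by rewrite !(derE dd, derE der_delta); ring.
  + by move=> f g; rewrite !(derE dd, derE der_delta); ring.
  + by move=> f; rewrite !(derE dd, derE der_delta, dh); ring.
- move=> a; rewrite DopK // E (mkK_surj a) !derK_mk mkK_scale mkK_add.
  by congr mkK; rewrite ?(derE der_delta); ring.
- have J1 := Inder_Dop mulJ p0J (x0 s) (x0 s').
  have J2 := Inder_Dop mulJ p0J (cJ c) (x0 s').
  have J3 := Inder_Dop mulJ p0J (x0 s) (cJ c').
  (* D(c, s' x) taken in [J] is [i] times the image of its namesake in [K], so it is multiplied by
     [- i]; D(s x, s' x) needs no correction. *)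
  have J4 := Inder_lin (- i) J2 J1; have J5 := Inder_lin (- i) J3 J4.
  apply: (Inder_ext _ (Inder_lin k J5 I)) => u; rewrite !DopJ.
  have [v0 [v1 [v2 [v3 [y0 [y1 [y2 [y3 ->]]]]]]]] := mkJ_surj u.
  have eiN : (- i)%:A = - iZ by rewrite scaleNr.
  rewrite !(evJ_mk, odJ_mk) !mkJ_add !mkJ_scale !mkJ_add !mkJ_scale !mkJ_add eiN.
  by congr mkJ; rewrite ?(derE der_delta, der_iZ der_delta); ring: iZ2.
Qed.

Lemma Inder_K_Derbar D : is_Inder mulK p0K D -> is_Derbar delta D.
Proof.
move=> /Inder_K_P [d [h [e [kd E _]]]]; apply/Derbar_P => //.
by exists d, h, e.
Qed.

Lemma inT_Inder_Derbar t : inT (is_Inder mulK p0K) t -> inT (is_Derbar delta) t.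
Proof. by move=> [sX /Inder_K_Derbar]. Qed.

Lemma phi_Inder t : inT (is_Inder mulK p0K) t -> is_Inder mulJ p0J (phi t).
Proof.
move=> [_ /Inder_K_P [d [h [e [[dd _] E I]]]]].
have phit u := phiE u (mkK_surj (t.1 o2 o1)) (mkK_surj (t.1 o0 o2))
  (mkK_surj (t.1 o1 o0)) (der0 dd) (der1 dd) E.
move: phit; move: (t.1 o2 o1 ord0) (t.1 o0 o2 ord0) (t.1 o1 o0 ord0) => a1 a2 a3.
move: (t.1 o2 o1 ord_max) (t.1 o0 o2 ord_max) (t.1 o1 o0 ord_max) => b1 b2 b3 phit.
(* The arguments are chosen from [DopJ] so that each operator contributes exactly one of the
   parameters [a_j], [b_j]. *)
have IA1 := Inder_Dop mulJ p0J (w3 (iZ * a1)) (w2 1).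
have IA2 := Inder_Dop mulJ p0J (w3 (- iZ * a2)) (w1 1).
have IA3 := Inder_Dop mulJ p0J (w2 a3) (w1 1).
have IB1 := Inder_Dop mulJ p0J (x0 b1) (w1 1).
have IB2 := Inder_Dop mulJ p0J (x0 b2) (w2 1).
have IB3 := Inder_Dop mulJ p0J (x0 b3) (w3 iZ).
have := Inder_add (Inder_add (Inder_add IA1 IA2) (Inder_add IA3 IB1))
  (Inder_add (Inder_add IB2 IB3) I).
apply: Inder_ext => u; rewrite phit !DopJ.
have [v0 [v1 [v2 [v3 [y0 [y1 [y2 [y3 ->]]]]]]]] := mkJ_surj u.
rewrite !(evJ_mk, odJ_mk) !mkJ_add.
by congr mkJ; rewrite ?(derE der_delta, der_iZ der_delta); ring: iZ2.
Qed.

(** If [e] is the sum of the [f * delta g], then eta_e is the sum of the D(g, f x). *)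
Lemma Inder_eta e : is_Inder mulK p0K (derK (fun=> 0) 0 e).
Proof.
have [l ->] := delta_span e.
exists [seq (1, mkK p.2 0, mkK 0 p.1) | p <- l] => a; rewrite big_map.
elim: l => [|p l IH].
  by rewrite !big_nil /derK !mul0r !addr0 -mkK_0.
rewrite !big_cons -IH /= DopK // scale1r (mkK_surj a) !derK_mk !mkK_add.
by congr mkK; rewrite ?(derE der_delta); ring.
Qed.

Lemma inT_tlin k t t' : inT (is_Inder mulK p0K) t -> inT (is_Inder mulK p0K) t' ->
  inT (is_Inder mulK p0K) (tlin k t t').
Proof.
move=> [sX I] [sX' I']; split; last exact: Inder_lin.
by move=> j l; rewrite /= sX sX' scalerN opprD.
Qed.

Lemma phi_Inder_surj D : is_Inder mulJ p0J D ->
  exists t, inT (is_Inder mulK p0K) t /\ forall v, phi t v = D v.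
Proof.
move: D; apply: Inder_ind => [f g fg [t [It Et]] | | k A B f _ [t [It Et]]].
- by exists t; split=> // v; rewrite Et.
- exists (skewK 0 0 0, derK (fun=> 0) 0 0); split.
    by split; [exact: skewKP | exact: Inder_eta].
  move=> v; rewrite mkK_0 phi_skewK; last first.
    by split=> [l a b|a b]; rewrite ?scaler0 ?mulr0 ?mul0r addr0.
  have [v0 [v1 [v2 [v3 [y0 [y1 [y2 [y3 ->]]]]]]]] := mkJ_surj v.
  rewrite !(evJ_mk, odJ_mk) !mkJ_add.
  by rewrite mkJ_0; congr mkJ; rewrite ?(der0 der_delta); ring.
have [c [u1 [u2 [u3 [s [t1 [t2 [t3 ->]]]]]]]] := mkJ_surj A.
have [c' [u1' [u2' [u3' [s' [t1' [t2' [t3' ->]]]]]]]] := mkJ_surj B.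
have [T [IT ET]] : exists T, inT (is_Inder mulK p0K) T /\ forall v,
    phi T v = Dop mulJ p0J (mkJ c u1 u2 u3 s t1 t2 t3) (mkJ c' u1' u2' u3' s' t1' t2' t3') v.
  (* The parameters are left open and filled by unification with [DopJ]. *)
  eexists (skewK (mkK _ _) (mkK _ _) (mkK _ _), derK _ _ _); split; last first.
    move=> v; rewrite DopJ phi_skewK; first by [].
    split=> [l a b|a b]; last by rewrite !(derE der_delta); ring.
    by rewrite -[l *: a]mulr_algl -[X in _ = X + _]mulr_algl !(derE der_delta); ring.
  split; first exact: skewKP.
  set e := (X in derK _ _ X).
  (* The component in the derivations of [K] is D(s x, s' x) plus some eta_e, and both are inner. *)
  apply: (Inder_ext _ (Inder_add (Inder_Dop mulK p0K (mkK 0 s) (mkK 0 s')) (Inder_eta e))) => a.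
  rewrite DopK // (mkK_surj a) /= !derK_mk mkK_add.
  by congr mkK; rewrite ?(mkK0E, mkK1E, derE der_delta); ring.
exists (tlin k T t); split; first exact: inT_tlin.
by move=> v; rewrite phi_lin ?ET ?Et //; apply: inT_Inder_Derbar.
Qed.

End Model.

(** * Both isomorphisms, given by the same map [phi] *)

Theorem theorem7p1 (F : fieldType) (Z : comAlgType F) (delta : Z -> Z) :
  (2%:R : F) != 0 ->
  (exists i : F, i * i = -1) ->
  (forall (k : F) (f g : Z), delta (k *: f + g) = k *: delta f + delta g) ->
  (forall f g : Z, delta (f * g) = delta f * g + f * delta g) ->
  (forall z : Z, exists s : seq (Z * Z), z = \sum_(p <- s) p.1 * delta p.2) ->
  tits_iso (mulK delta) (p0K (Z:=Z)) (p0J (Z:=Z))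
           (is_Der (mulJ delta) (p0J (Z:=Z))) (is_Derbar delta)
  /\
  tits_iso (mulK delta) (p0K (Z:=Z)) (p0J (Z:=Z))
           (is_Inder (mulJ delta) (p0J (Z:=Z))) (is_Inder (mulK delta) (p0K (Z:=Z))).
Proof.
move=> char2 [i ii] delta_lin delta_mul delta_span.
have dd : is_der delta by split.
(* Through this inclusion the restricted map inherits injectivity, linearity and compatibility with
   parity and bracket; only its image needs separate treatment. *)
have IK t : inT (is_Inder (mulK delta) (p0K (Z:=Z))) t -> inT (is_Derbar delta) t.
  exact: inT_Inder_Derbar dd ii t.
split; exists (phi delta i); (split; [|split; [|split; [|split; [|split]]]]).
- by move=> t; apply: phi_Der.
- by move=> D; apply: phi_surj.
- by move=> t t'; apply: phi_inj.
- by move=> k t t'; apply: phi_lin.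
- by move=> b t; apply: phi_part.
- by move=> t t' It It' v; apply: phi_bracket.
- by move=> t; apply: phi_Inder.
- by move=> D; apply: phi_Inder_surj.
- by move=> t t' /IK It /IK It'; apply: phi_inj.
- by move=> k t t' /IK It /IK It'; apply: phi_lin.
- by move=> b t /IK It; apply: phi_part.
- by move=> t t' /IK It /IK It' v; apply: phi_bracket.
Qed.
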